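(* Let $G$ be an abelian, locally quasiconvex, locally $k_\omega$ group. Then the following hold: (i) $G$ respects any compact-like property $\mathcal{P}$ stronger than or equal to functional boundedness. (ii) $G$ strongly respects compactness.
   Context: All topological spaces are assumed to be infinite, completely regular and Hausdorff. A Hausdorff space $X$ is a $k_\omega$-space if there is an ascending sequence of compact subsets $K_1\subseteq K_2\subseteq\cdots\subseteq X$ with $X=\bigcup_{n<\omega}K_n$ such that $U\subseteq X$ is open if and only if $U\cap K_n$ is open in $K_n$ for each $n$. A Hausdorff space is locally $k_\omega$ if each point has an open neighbourhood that is a $k_\omega$-space in the induced topology. A locally $k_\omega$ group is a topological group whose underlying space is locally $k_\omega$. For an abelian topological group $G$, $\widehat G$ is the group of continuous characters $\chi\colon G\to\mathbb{T}$, with $\mathbb{T}$ identified with the additive group $[-1/2,1/2)$ (modulo 1). For $A\subseteq G$ put $A^{\rhd}=\{\chi\in\widehat G:|\chi(a)|\le 1/4\ \text{for all } a\in A\}$, and for $X\subseteq\widehat G$ put $X^{\lhd}=\{g\in G:|\chi(g)|\le1/4\ \text{for all }\chi\in X\}$. A set $A\subseteq G$ is quasiconvex if $A^{\rhd\lhd}=A$, and $G$ is locally quasiconvex if it has a neighbourhood base at $0$ consisting of quasiconvex sets. The Bohr compactification of $G$ is a pair $(bG,b)$ with $bG$ a compact Hausdorff group and $b$ a continuous homomorphism of $G$ onto a dense subgroup of $bG$ such that every continuous homomorphism $h\colon G\to K$ into a compact group extends to a continuous homomorphism $h^b\colon bG\to K$ with $h=h^b\circ b$. For a locally quasiconvex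 (Hausdorff) abelian group, $b$ is injective and $G$ is regarded algebraically as a subgroup of $bG$. $G^+$ denotes the group $G$ equipped with the Bohr topology, i.e. the topology induced by $b$ from $bG$. A subset $A$ of a space $X$ is functionally bounded when every real-valued continuous function on $X$ is bounded on $A$. A topological property $\mathcal{P}$ on $X$ is stronger than or equal to functional boundedness if every $A\subseteq X$ that satisfies $\mathcal{P}$ is functionally bounded. The term ''compact-like'' is descriptive and carries no separate formal definition: $\mathcal{P}$ is a topological property stronger than or equal to functional boundedness (properties of the kind considered are compactness, countable compactness, pseudocompactness, functional boundedness). $G$ respects $\mathcal{P}$ when $G$ and $G^+$ have the same subsets satisfying $\mathcal{P}$. For a closed subgroup $N$ of $bG$, let $\pi\colon bG\to bG/N$ be the canonical projection and $b_N=\pi\circ b$. $G$ strongly respects compactness if for every closed metrizable subgroup $N$ of $bG$ and every subset $A$ of $G$: $A+(N\cap G)$ is compact in $G$ if and only if $b_N(A)$ is compact in $bG/N$.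
   Formalization: In (i), 𝒫 is also assumed to depend, for subsets of a compact subspace, only on that subspace (true of compactness, countable compactness, pseudocompactness, functional boundedness); else ''A finite and X discrete'' is a counterexample for G = ℤ. *)

(* Defs.v *)
From HB Require Import structures.
From mathcomp Require Import all_boot all_order all_algebra.
From mathcomp Require Import all_classical all_reals all_analysis.

Set Implicit Arguments.
Unset Strict Implicit.
Unset Printing Implicit Defensive.

Import Order.TTheory GRing.Theory Num.Theory.
Import numFieldNormedType.Exports.

Local Open Scope classical_set_scope.
Local Open Scope ring_scope.
Local Open Scope quotient_scope.

Definition tychonoff (X : topologicalType) :=
  completely_regular_space X /\ hausdorff_space X.

Definition homeomorphic (X Y : topologicalType) :=
  exists (f : X -> Y) (g : Y -> X),
    [/\ continuous f, continuous g, cancel f g & cancel g f].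

Definition metrizable (R : realType) (X : topologicalType) :=
  exists M : metricType R, homeomorphic X M.

Definition k_omega (X : topologicalType) :=
  hausdorff_space X /\
  exists K : nat -> set X,
    [/\ forall n, compact (K n),
        forall n, K n `<=` K n.+1,
        \bigcup_n K n = [set: X] &
        forall U : set X,
          open U <-> forall n, open (U `&` K n : set (subspace (K n)))].

Definition locally_k_omega (X : topologicalType) :=
  hausdorff_space X /\
  forall x : X, exists U : set X, [/\ open U, U x & k_omega (set_type U)].

Definition integers (R : realType) : zmodClosed R :=
  GRing.ZmodClosed.clone R (@Num.int_num_subdef R) _.

Definition circle (R : realType) : Type :=
  quotient_topology (Quotient.quot (integers R)).

HB.instance Definition _ (R : realType) := Topological.on (circle R).
HB.instance Definition _ (R : realType) :=
  GRing.Zmodule.copy (circle R) (Quotient.quot (integers R)).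

(** The representative of [t] in [-1/2, 1/2[. *)
Definition circle_rep (R : realType) (t : circle R) : R :=
  let r : R := repr t in r - (Num.floor (r + 2^-1))%:~R.

Section Quasiconvex.
Variables (R : realType) (G : topologicalZmodType).

Definition characters : set (G -> circle R) :=
  [set chi : G -> circle R | continuous chi /\ {morph chi : x y / x + y}].

Definition polar (A : set G) : set (G -> circle R) :=
  [set chi | characters chi /\
             forall a, A a -> `|circle_rep (chi a)| <= 4^-1].

Definition prepolar (X : set (G -> circle R)) : set G :=
  [set g | forall chi, X chi -> `|circle_rep (chi g)| <= 4^-1].

Definition quasiconvex (A : set G) := prepolar (polar A) = A.

Definition locally_quasiconvex :=
  forall U : set G, nbhs 0 U ->
    exists V : set G, [/\ nbhs 0 V, V `<=` U & quasiconvex V].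

End Quasiconvex.

HB.structure Definition PreTopologicalGroup :=
  {K of Topological K & Group K}.

HB.mixin Record PreTopologicalGroup_isTopologicalGroup K
    & PreTopologicalGroup K := {
  mulg_continuous : continuous (fun x : K * K => (x.1 * x.2)%g) ;
  invg_continuous : continuous (fun x : K => (x^-1)%g)
}.

#[short(type="topologicalGroupType")]
HB.structure Definition TopologicalGroup :=
  {K of PreTopologicalGroup K & PreTopologicalGroup_isTopologicalGroup K}.

(** The compact groups [K] of the universal property need not be abelian, hence
    are written multiplicatively; [bG] itself is abelian since it has a dense
    abelian subgroup. *)
Definition bohr_compactification (G bG : topologicalZmodType) (b : G -> bG) :=
  [/\ compact [set: bG] /\ hausdorff_space bG,
      continuous b,
      {morph b : x y / x + y},
      dense (range b) &
      forall (K : topologicalGroupType) (h : G -> K),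
        compact [set: K] -> hausdorff_space K ->
        continuous h -> {morph h : x y / x + y >-> (x * y)%g} ->
        exists hb : bG -> K,
          [/\ continuous hb, {morph hb : x y / x + y >-> (x * y)%g} &
              forall x, h x = hb (b x)]].

Definition functionally_bounded (R : realType) (X : topologicalType)
    (A : set X) :=
  forall f : X -> R, continuous f -> bounded_set (f @` A).

Definition subset_property := forall X : topologicalType, set X -> Prop.

Definition topological_property (P : subset_property) :=
  forall (X Y : topologicalType) (A : set X) (B : set Y),
    homeomorphic (set_type A) (set_type B) -> P X A -> P Y B.

(** A property such as functional boundedness of [A] in [X] is not determined by
    the space [A] alone, so [topological_property] would exclude it; invariance
    under homeomorphisms of pairs [(X, A)] would on the other hand let in
    properties like "[A] is finite and [X] is discrete", which no infinite
    discrete group respects.  The requirement below is that [P], on subsets of a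
    compact subspace, is determined by that subspace and not by what surrounds
    it.  (In a Tychonoff space, a continuous injection of a compact space is an
    embedding.)  It holds for every [topological_property], such as compactness,
    countable compactness and pseudocompactness, and for functional boundedness:
    see the two lemmas at the end of the file. *)
Definition compact_intrinsic (P : subset_property) :=
  forall (K X : topologicalType) (e : K -> X) (A : set K),
    compact [set: K] -> tychonoff X -> continuous e -> injective e ->
    (P K A <-> P X (e @` A)).

Definition stronger_than_functional_boundedness (R : realType)
    (P : subset_property) (X : topologicalType) :=
  forall A : set X, P X A -> functionally_bounded R A.

Definition respects (G bG : topologicalZmodType) (b : G -> bG)
    (P : subset_property) :=
  forall A : set G, P G A <-> P (initial_topology b) A.

(** [G] is viewed inside [bG] through [b], so [N `&` G] is [b @^-1` N]. *)
Definition strongly_respects_compactness (R : realType)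
    (G bG : topologicalZmodType) (b : G -> bG) :=
  forall N : zmodClosed bG,
    closed [set x : bG | x \in N] ->
    metrizable R (set_type [set x : bG | x \in N]) ->
    forall A : set G,
      compact [set a + n | a in A & n in [set n : G | b n \in N]] <->
      compact ((fun a => \pi_(quotient_topology (Quotient.quot N)) (b a)) @` A).

Lemma functionally_bounded_compact_intrinsic (R : realType) :
  compact_intrinsic (@functionally_bounded R).
Proof.
move=> K X e A cK _ ce _.
have bK (g : K -> R) : continuous g -> bounded_set (g @` A).
  move=> cg; have : bounded_set (g @` setT).
    by apply: compact_bounded; apply: continuous_compact => //;
       exact: continuous_subspaceT.
  case=> M [Mr gM]; exists M; split=> // m Mm _ [x _ <-].
  by apply: (gM _ Mm); exists x.
split=> _ f cf; last exact: bK.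
rewrite image_comp; apply: bK => x.
by apply: continuous_comp; [exact: ce|exact: cf].
Qed.

Lemma topological_compact_intrinsic (P : subset_property) :
  topological_property P -> compact_intrinsic P.
Proof.
move=> topP K X e A cK [_ hX] ce ie.
have [f [g [cf cg fK gK]]] : homeomorphic (set_type A) (set_type (e @` A)).
  have fP (x : set_type A) : e (set_val x) \in e @` A.
    by apply/mem_set; exists (set_val x) => //; exact: set_valP.
  have gP (y : set_type (e @` A)) :
      exists x : set_type A, e (set_val x) = set_val y.
    have [x Ax exy] := set_valP y.
    by exists (SigSub (mem_set Ax)).
  pose f x : set_type (e @` A) := SigSub (fP x).
  pose g y : set_type A := projT1 (cid (gP y)).
  have eg y : e (set_val (g y)) = set_val y := projT2 (cid (gP y)).
  have fK : cancel f g.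
    by move=> x; apply/val_inj/ie; exact: eg.
  have gK : cancel g f.
    by move=> y; apply/val_inj; exact: eg.
  exists f, g; split=> //.
    apply/continuousP => _ [U oU <-].
    exists (e @^-1` U) => //.
    by move/continuousP : ce; exact.
  apply/continuousP => _ [U oU <-].
  exists (~` (e @` (~` U))).
    rewrite openC; apply: compact_closed => //.
    apply: continuous_compact; first exact: continuous_subspaceT.
    by apply: (subclosed_compact _ cK) => //; exact: open_closedC.
  apply/seteqP; split=> y /=.
    by apply: contra_notP => nU; exists (set_val (g y)) => //; exact: eg.
  move=> Ug [x nUx exy]; apply: nUx.
  by rewrite (_ : x = set_val (g y))//; apply: ie; rewrite eg.
split; first by apply: topP; exists f, g.
by apply: topP; exists g, f.
Qed.

(* Main.v *)
Require Import Defs.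
From HB Require Import structures.
From mathcomp Require Import all_boot all_order all_algebra.
From mathcomp Require Import all_classical all_reals all_analysis.
From mathcomp Require Import lra zify.
Set Implicit Arguments.
Unset Strict Implicit.
Unset Printing Implicit Defensive.
Import Order.TTheory GRing.Theory Num.Theory.
Import numFieldNormedType.Exports.
Local Open Scope classical_set_scope.
Local Open Scope ring_scope.

(** Write H for an open subgroup of G that is the union of compact sets
    L_0 <= L_1 <= ..., with L_n + L_n <= L_(n+1), absorbing the compact sets that
    determine the topology near 0.  Two facts bound subsets A of H.

    First, if A is not contained in any hull of L_n, there are x_n in A and
    characters chi_n, small on L_n, with |chi_n(x_n)| > 1/4.  On H they tend to 0
    geometrically; as geometrically decaying sequences in the circle form a
    divisible, hence injective, group, they may be extended to all of G with the
    same property.  Then every sum of a subsequence of the chi_n is a continuous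
    character.  If sequences in A cluster in G along countable sets of characters
    (which follows from functional boundedness in G^+), a gliding hump yields sums
    that separate a convergent subsequence of (x_n) from itself.  For strong respect
    only characters trivial on N may be used; since N is compact metrizable its dual
    is countable, so among the uncountably many sums two agree on N, and their
    difference serves.

    Second, the hull of a compact set is precompact by Ascoli's theorem, and a
    precompact subset of H lies in some L_n: otherwise it contains b_n such that the
    differences b_n - b_i, i < n, form a closed set missing 0.

    A set as above meets only finitely many cosets of H, since a sequence in
    distinct cosets can be put into a larger group of the same kind as H. *)

Lemma subrACA (V : zmodType) (a b c d : V) : (a - b) - (c - d) = (a - c) - (b - d).
Proof. by rewrite !opprD addrACA. Qed.

(** * The circle group *)

Section Circle.
Variable R : realType.
Implicit Types (r : R) (s t : circle R).

Definition cpi r : circle R := \pi_(Quotient.quot (integers R))%qT r.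

Lemma cpiD : {morph cpi : x y / x + y}.
Proof. by move=> x y; rewrite /cpi [LHS]raddfD. Qed.

Lemma cpiN : {morph cpi : x / - x}.
Proof. by move=> x; rewrite /cpi [LHS]raddfN. Qed.

Lemma cpi_eqP (x y : R) : cpi x = cpi y <-> exists k : int, x - y = k%:~R.
Proof.
have -> : (cpi x = cpi y) <-> (x - y) \in integers R.
  rewrite Quotient.idealrBE.
  exact: (rwP (@eqP (Quotient.quot (integers R)) _ _)).
have -> : (x - y \in integers R) = (x - y \is a Num.int) by [].
exact: (iff_sym (rwP intrP)).
Qed.

Lemma circle_repK t : cpi (circle_rep t) = t.
Proof.
rewrite /circle_rep; set r := repr t.
have -> : t = cpi r by rewrite /cpi/r reprK.
by apply/cpi_eqP; exists (- Num.floor (r + 2^-1)); rewrite rmorphN/= addrAC subrr add0r.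
Qed.

Lemma circle_rep_range t : - 2^-1 <= circle_rep t < 2^-1.
Proof.
rewrite /circle_rep; set r : R := repr t.
have /andP[] := floor_itv (r + 2^-1); rewrite intrD.
by move=> h1 h2; apply/andP; split; lra.
Qed.

(** Distance of a representative to the nearest integer; polars are given by the bound 1/4 on it. *)
Definition cnorm t : R := `|circle_rep t|.

Lemma cnorm_ge0 t : 0 <= cnorm t.
Proof. exact: normr_ge0. Qed.

Lemma cnorm_le_half t : cnorm t <= 2^-1.
Proof. by rewrite /cnorm ler_norml; have /andP[-> /ltW ->] := circle_rep_range t. Qed.

Lemma circle_rep_cpi r : exists k : int, circle_rep (cpi r) = r + k%:~R.
Proof.
have /cpi_eqP[k kE] := circle_repK (cpi r).
by exists k; rewrite -kE addrC subrK.
Qed.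

Lemma cnorm_cpi_le r : cnorm (cpi r) <= `|r|.
Proof.
have [k] := circle_rep_cpi r; have := cnorm_le_half (cpi r).
rewrite /cnorm; set x := circle_rep _ => xh xE.
have -> : r = x - k%:~R by rewrite xE addrK.
have [->|k0] := eqVneq k 0; first by rewrite subr0.
have k1 : 1 <= `|k%:~R : R| by rewrite -intr_norm ler1z lez_nat /= absz_gt0.
by have := lerB_dist (k%:~R : R) x; rewrite (distrC x); lra.
Qed.

Lemma cnorm_cpi r : `|r| <= 2^-1 -> cnorm (cpi r) = `|r|.
Proof.
have [k] := circle_rep_cpi r; have := cnorm_cpi_le r.
rewrite /cnorm; set x := circle_rep _ => xh xE rh.
apply/eqP; rewrite eq_le xh/= xE.
have [->|k0] := eqVneq k 0; first by rewrite addr0.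
have k1 : 1 <= `|k%:~R : R| by rewrite -intr_norm ler1z lez_nat /= absz_gt0.
by have := lerB_dist (k%:~R : R) (-r); rewrite opprK normrN (addrC r); lra.
Qed.

Lemma cnorm0 : cnorm 0 = 0.
Proof.
have -> : 0 = cpi 0 by rewrite /cpi [RHS]raddf0.
by apply/eqP; rewrite eq_le cnorm_ge0 -[leRHS](@normr0 _ R) cnorm_cpi_le.
Qed.

Lemma cnorm_eq0 t : cnorm t = 0 -> t = 0.
Proof.
move=> /normr0_eq0 t0; rewrite -(circle_repK t) t0.
by rewrite /cpi [LHS]raddf0.
Qed.

Lemma cnormN t : cnorm (- t) = cnorm t.
Proof.
rewrite -(circle_repK t) -cpiN; have := cnorm_le_half t; rewrite /cnorm => th.
by rewrite -!/(cnorm _) !cnorm_cpi ?normrN.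
Qed.

Lemma cnormD s t : cnorm (s + t) <= cnorm s + cnorm t.
Proof.
rewrite -{1}(circle_repK t) -{1}(circle_repK s) -cpiD.
by apply: le_trans (cnorm_cpi_le _) _; exact: ler_normD.
Qed.

Lemma cdistC s t : cnorm (s - t) = cnorm (t - s).
Proof. by rewrite -cnormN opprB. Qed.

Lemma cdistD u s t : cnorm (s - t) <= cnorm (s - u) + cnorm (u - t).
Proof. by have := cnormD (s - u) (u - t); rewrite addrA subrK. Qed.

Lemma cnormB s t : cnorm (s - t) <= cnorm s + cnorm t.
Proof. by have := cnormD s (- t); rewrite cnormN. Qed.

Lemma cnorm_distB s t : cnorm s - cnorm t <= cnorm (s - t).
Proof. by have := cnormD (s - t) t; rewrite subrK; lra. Qed.

Lemma cnorm_sum (I : Type) (l : seq I) (P : pred I) (F : I -> circle R) :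
  cnorm (\sum_(i <- l | P i) F i) <= \sum_(i <- l | P i) cnorm (F i).
Proof.
elim/big_ind2 : _ => //; first by rewrite cnorm0.
by move=> x r y r' xr yr'; apply: le_trans (cnormD _ _) _; exact: lerD.
Qed.

Lemma cnormMn t n : cnorm (t *+ n) <= n%:R * cnorm t.
Proof.
elim: n => [|n IH]; first by rewrite mulr0n cnorm0 mul0r.
rewrite mulrS; apply: le_trans (cnormD _ _) _.
by rewrite -natr1 mulrDl mul1r addrC lerD2r.
Qed.

Lemma cnorm_double t : cnorm t <= 4^-1 -> cnorm (t + t) = cnorm t + cnorm t.
Proof.
move=> t4; rewrite -{1 2}(circle_repK t) -cpiD.
move: t4; rewrite /cnorm => t4.
have -> : `|circle_rep t| + `|circle_rep t| = `|circle_rep t + circle_rep t|.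
  by rewrite -mulr2n -[in RHS]mulr2n normrMn.
rewrite -/(cnorm _) cnorm_cpi// -[X in `|X|]mulr2n normrMn mulr2n; lra.
Qed.

(** Doubling an element of norm at most 1/4 doubles its norm exactly. This is the source of the
    geometric decay of characters below. *)
Lemma cnorm_dyadic t k : (forall j, (j <= k)%N -> cnorm (t *+ 2 ^ j) <= 4^-1) ->
  cnorm t <= 4^-1 * 2^-1 ^+ k.
Proof.
move=> h.
suff H j : (j <= k)%N -> cnorm (t *+ 2 ^ j) = 2 ^+ j * cnorm t.
  have := h k (leqnn k); rewrite H// exprVn.
  by rewrite -ler_pdivlMl ?exprn_gt0// mulrC.
elim: j => [|j IH] jk; first by rewrite mulr1n expr0 mul1r.
rewrite expnSr mulrnA mulr2n cnorm_double; last exact/h/ltnW.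
rewrite exprS -mulrA mulr_natl [RHS]mulr2n.
by congr (_ + _); apply: IH; exact: ltnW.
Qed.

(** The circle has no small subgroups: the dyadic bound holds for every exponent. *)
Lemma cnorm_subgroup t : (forall k, cnorm (t *+ k) <= 4^-1) -> t = 0.
Proof.
move=> h; apply: cnorm_eq0.
apply/eqP; rewrite eq_le cnorm_ge0 andbT; apply/ler_addgt0Pl => e e0.
rewrite addr0.
have [k ke] : exists k, 2^-1 ^+ k < e.
  have := @cvg_expr R 2^-1; rewrite ger0_norm// => /(_ ltac:(lra)).
  move=> /cvgrPdist_lt /(_ e e0) [k _ /(_ k (leqnn k))].
  by rewrite sub0r normrN ger0_norm ?exprn_ge0//; exists k.
have := @cnorm_dyadic t k (fun j _ => h _).
have : 0 <= 2^-1 ^+ k :> R by rewrite exprn_ge0.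
lra.
Qed.

(** Dividing the representative in [-1/2, 1/2) gives a root that is no larger, so roots of decaying
    sequences can be taken termwise. *)
Lemma circle_root t k : (0 < k)%N ->
  exists2 s, s *+ k = t & cnorm s <= cnorm t.
Proof.
move=> k0; exists (cpi (circle_rep t / k%:R)).
  have cM x n : cpi x *+ n = cpi (x *+ n).
    by elim: n => [|n IH]; rewrite ?mulr0n ?mulrS ?cpiD ?IH// /cpi [RHS]raddf0.
  rewrite cM (_ : _ *+ k = circle_rep t); first exact: circle_repK.
  by rewrite -[LHS]mulr_natr divfK// pnatr_eq0 -lt0n.
apply: le_trans (cnorm_cpi_le _) _.
rewrite normrM ler_piMr// normfV ger0_norm// invf_le1 ?ltr0n//.
by rewrite ler1n.
Qed.

Lemma nbhs_circleP t (A : set (circle R)) :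
  nbhs t A <-> exists2 e : R, 0 < e & forall s, cnorm (s - t) < e -> A s.
Proof.
split.
  rewrite nbhsE /= => -[U [oU Ut] UA].
  have oV : open (cpi @^-1` U) := oU.
  have Vr : (cpi @^-1` U) (circle_rep t) by rewrite /preimage/= circle_repK.
  have : nbhs (circle_rep t) (cpi @^-1` U) by exact: open_nbhs_nbhs.
  move=> /nbhs_ballP[e /= e0 eU]; exists e => // s st; apply: UA.
  have := eU (circle_rep t + circle_rep (s - t)).
  rewrite /preimage/= cpiD !circle_repK (_ : t + (s - t) = s); last first.
    by rewrite addrC subrK.
  apply.
  by rewrite /ball /= opprD addrA subrr sub0r normrN.
case=> e e0 eA; rewrite nbhsE /=.
exists [set s | cnorm (s - t) < e] => //; split; last by rewrite /= subrr cnorm0.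
rewrite /open/= /quotient_open.
have -> : \pi_(quotient_topology (Quotient.quot (integers R)))%qT @^-1`
    [set s | cnorm (s - t) < e] = [set r | cnorm (cpi r - t) < e] by [].
rewrite openE => r /= re; apply/nbhs_ballP => /=.
exists (e - cnorm (cpi r - t)) => /=; first by rewrite subr_gt0.
move=> r' rr'; rewrite /= in rr' *.
have := cdistD (cpi r) (cpi r') t.
have : cnorm (cpi r' - cpi r) <= `|r - r'|.
  by rewrite -cpiN -cpiD distrC; exact: cnorm_cpi_le.
rewrite /ball/= in rr'; lra.
Qed.

Lemma near_circle t (e : R) : 0 < e -> \forall s \near t, cnorm (s - t) < e.
Proof. by move=> e0; apply/nbhs_circleP; exists e. Qed.

Lemma cvg_circleP (T : Type) (F : set_system T) (FF : Filter F) (f : T -> circle R) t :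
  f @ F --> t <-> forall e : R, 0 < e -> \forall x \near F, cnorm (f x - t) < e.
Proof.
split=> [ft e e0|h A].
  by apply: (ft [set s | cnorm (s - t) < e]); exact: near_circle.
by move=> /nbhs_circleP[e e0 eA]; rewrite nbhs_simpl; apply: filterS (h e e0) => x /eA.
Qed.

Lemma cts_circleP (X : topologicalType) (f : X -> circle R) x :
  {for x, continuous f} <->
  forall e : R, 0 < e -> \forall y \near x, cnorm (f y - f x) < e.
Proof. exact: cvg_circleP. Qed.

Lemma circle_hausdorff : hausdorff_space (circle R).
Proof.
move=> s t /= st; apply: subr0_eq; apply/cnorm_eq0/eqP.
rewrite eq_le cnorm_ge0 andbT; apply/ler_addgt0Pl => e e0; rewrite addr0.
have e20 : 0 < e / 2 by lra.
have [u [us ut]] := st _ _ (near_circle s e20) (near_circle t e20).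
by move: us ut => /= us ut; have := cdistD u s t; rewrite (cdistC s u); lra.
Qed.

Lemma circle_compact : compact [set: circle R].
Proof.
have -> : [set: circle R] = cpi @` `[- 2^-1, 2^-1]%classic.
  apply/seteqP; split=> // t _; exists (circle_rep t); last exact: circle_repK.
  by have /andP[h1 /ltW h2] := circle_rep_range t; rewrite /= in_itv /= h1 h2.
apply: continuous_compact; last exact: segment_compact.
apply: continuous_subspaceT => x.
by have := @pi_continuous _ (Quotient.quot (integers R)) x.
Qed.

End Circle.

(** * Extension of homomorphisms into divisible groups *)

Lemma geometric_lt (R : realType) (c e : R) :
  0 < e -> exists k, c * 2^-1 ^+ k < e.
Proof.
move=> e0; have [c0|c0] := leP c 0.
  by exists 0%N; rewrite expr0 mulr1; exact: le_lt_trans e0.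
have := @cvg_expr R 2^-1; rewrite ger0_norm// => /(_ ltac:(lra)).
move=> /cvgrPdist_lt /(_ (e / c)); rewrite divr_gt0// => /(_ isT).
move=> [k _ /(_ k (leqnn k))]; rewrite sub0r normrN ger0_norm ?exprn_ge0// => h.
by exists k; rewrite mulrC -ltr_pdivlMr.
Qed.

Section Extension.
Variables (G V : zmodType) (D : set V).
Hypothesis D0 : D 0.
Hypothesis DB : forall u v, D u -> D v -> D (u - v).
Hypothesis Ddiv : forall v k, D v -> (0 < k)%N -> exists2 w, D w & w *+ k = v.

(** Partial homomorphisms into the divisible subgroup [D], encoded as graphs: subgroups of [G * V]
    with trivial fibre over 0. Unions of nonempty chains are again of this kind. *)
Let hom_graph (Gr : set (G * V)) :=
  [/\ Gr (0, 0),
      forall p q, Gr p -> Gr q -> Gr (p - q),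
      forall p, Gr p -> D p.2 &
      forall v, Gr (0, v) -> v = 0].

Let pairB (a c : G) (b d : V) : (a, b) - (c, d) = (a - c, b - d).
Proof. by []. Qed.

Let pairMz (a : G) (b : V) (k : int) : (a, b) *~ k = (a *~ k, b *~ k).
Proof.
have fstM : {morph (@fst G V) : p / p *~ k} by move=> p; exact: (raddfMz fst).
have sndM : {morph (@snd G V) : p / p *~ k} by move=> p; exact: (raddfMz snd).
by rewrite [LHS]surjective_pairing fstM sndM.
Qed.

Let hom_graph_mulrz Gr p k : hom_graph Gr -> Gr p -> Gr (p *~ k).
Proof.
move=> [G0 GB _ _] Gp.
have GN q : Gr q -> Gr (- q) by move=> Gq; rewrite -sub0r; exact: GB.
have Gn n : Gr (p *+ n).
  elim: n => [|n IH]; first exact: G0.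
  by rewrite mulrSr -[X in _ + X]opprK; apply: GB => //; exact: GN.
by case: k => n; [exact: Gn|rewrite NegzE mulrNz; exact/GN/Gn].
Qed.

Let hom_graph_adjoin Gr x : hom_graph Gr ->
  exists w, hom_graph [set p | exists k : int, Gr (p - (x, w) *~ k)].
Proof.
move=> hG; have [G0 GB GD Gf] := hG.
have DM w k : D w -> D (w *~ k).
  move=> Dw; have DN v : D v -> D (- v) by move=> Dv; rewrite -sub0r; exact: DB.
  have Dn n : D (w *+ n).
    elim: n => [|n IH]; first exact: D0.
    by rewrite mulrSr -[X in _ + X]opprK; apply: DB => //; exact: DN.
  by case: k => n; [exact: Dn|rewrite NegzE mulrNz; exact/DN/Dn].
suff [w Dw wP] : exists2 w, D w &
    forall (k : int) v, Gr (x *~ k, v) -> v = w *~ k.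
  exists w; split.
  - by exists 0; rewrite mulr0z subr0.
  - move=> p q [k pk] [l ql]; exists (k - l).
    suff -> : p - q - (x, w) *~ (k - l) = (p - (x, w) *~ k) - (q - (x, w) *~ l).
      exact: GB.
    rewrite mulrzBr !opprD !opprK addrACA; congr (_ + _).
  - move=> p [k /GD/= Dp].
    move: p => [a b] in Dp *; move: Dp; rewrite pairMz /= => Dp.
    have -> : b = (b - w *~ k) - w *~ (- k) by rewrite mulrNz opprK subrK.
    by apply: DB => //; exact: DM.
  - move=> v [k].
    rewrite pairMz pairB sub0r -mulrNz.
    by move=> /wP/eqP; rewrite mulrNz -subr_eq0 opprK subrK => /eqP.
(* If some positive multiple of [x] lies in the domain, take the least one, [m x], and let [w] be an
   [m]-th root of its value; otherwise [w = 0] works. *)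
pose I := [pred n | (0 < n)%N && `[< exists v, Gr (x *+ n, v) >]].
have [[n In]|nI] := pselect (exists n, I n); last first.
  exists 0 => // k v; case: k => [[|n]|n] hv.
  - by rewrite mulr0z in hv *; exact: Gf.
  - case: nI; exists n.+1; rewrite /I/=; apply/asboolP; by exists v.
  - case: nI; exists n.+1; rewrite /I/=; apply/asboolP; exists (- v).
    have := GB _ _ G0 hv.
    by rewrite pairB !sub0r NegzE mulrNz opprK.
case: (ex_minnP (ex_intro _ n In)) => m /andP[m0 /asboolP[v0 Gv0]] mmin.
have [w Dw wm] := Ddiv (GD _ Gv0) m0.
exists w => // k v Gv.
have km : (m %| k)%Z.
  apply/dvdz_mod0P.
  have rE := divz_eq k m.
  have m0' : m%:Z != 0 by rewrite eqz_nat -lt0n.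
  have r0 := modz_ge0 k m0'.
  have rm : (k %% m)%Z < m%:Z by apply: ltz_pmod; rewrite ltz_nat.
  case: (k %% m)%Z rE r0 rm => // r rE _ rm.
  apply/eqP; rewrite eqz_nat; apply/negPn/negP; rewrite -lt0n => r0.
  have : I r.
    rewrite /I/= r0/=; apply/asboolP.
    exists (v - v0 *~ (k %/ m)%Z).
    have := GB _ _ Gv (hom_graph_mulrz (k %/ m)%Z hG Gv0).
    rewrite pairMz pairB; congr (Gr (_, _)).
    by rewrite {1}rE mulrzDr -!pmulrn [_ * m%:Z]mulrC mulrzA addrAC subrr add0r.
  by move=> /mmin; rewrite leqNgt -ltz_nat rm.
have /dvdzP[q kq] := km.
have : Gr ((x *~ k, v) - (x *+ m, v0) *~ q) by apply: GB => //; exact: hom_graph_mulrz.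
rewrite pairMz pairB kq mulrC mulrzA -pmulrn subrr.
by move=> /Gf/eqP; rewrite subr_eq0 => /eqP ->; move: wm => /= <-; rewrite mulrzA -pmulrn.
Qed.

Lemma hom_extension (L : set G) (h : G -> V) :
  L 0 -> (forall x y, L x -> L y -> L (x - y)) ->
  (forall x, L x -> D (h x)) ->
  (forall x y, L x -> L y -> h (x - y) = h x - h y) ->
  exists h' : G -> V, [/\ {morph h' : x y / x + y}, forall x, D (h' x) &
                          forall x, L x -> h' x = h x].
Proof.
move=> L0 LB Lh hB.
have h0 : h 0 = 0 by have := hB _ _ L0 L0; rewrite subr0 subrr.
pose Gr0 : set (G * V) := [set p | L p.1 /\ p.2 = h p.1].
have hG0 : hom_graph Gr0.
  split.
  - by split => //=; rewrite h0.
  - by move=> p q [Lp pE] [Lq qE]; split => /=; [exact: LB|rewrite hB// pE qE].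
  - by move=> p [/Lh + ->].
  - by move=> v [_ /= ->].
(* The condition is put on the union with the given graph [Gr0], so that it also holds for the union
   of the empty chain. *)
pose P := [set Gr | hom_graph (Gr `|` Gr0)].
have [Gr [hG Gmax]] : exists A, P A /\ forall B, A `<` B -> ~ P B.
  apply: Zorn_bigcup => F FP Ftot; rewrite /P/=.
  set U := \bigcup_(X in F) X.
  have Upair p q : (U `|` Gr0) p -> (U `|` Gr0) q ->
      exists2 X, hom_graph X & [/\ X p, X q & X `<=` U `|` Gr0].
    have UX X : F X -> X `|` Gr0 `<=` U `|` Gr0.
      by move=> FX; apply: setSU => y Xy; exists X.
    case=> [[X FX Xp]|Gp]; case=> [[Y FY Yq]|Gq].
    - have [XY|YX] := Ftot _ _ FX FY.
      + exists (Y `|` Gr0); first exact: FP.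
        by split; [left; exact: XY|left|exact: UX].
      + exists (X `|` Gr0); first exact: FP.
        by split; [left|left; exact: YX|exact: UX].
    - by exists (X `|` Gr0); [exact: FP|split; [left|right|exact: UX]].
    - by exists (Y `|` Gr0); [exact: FP|split; [right|left|exact: UX]].
    - by exists Gr0 => //; split => // y; right.
  split.
  - by right; have [] := hG0.
  - by move=> p q Up Uq; have [X [_ XB _ _] [Xp Xq]] := Upair _ _ Up Uq; apply; exact: XB.
  - by move=> p Up; have [X [_ _ XD _] [Xp _ _]] := Upair _ _ Up Up; exact: XD.
  - by move=> v Up; have [X [_ _ _ Xf] [Xp _ _]] := Upair _ _ Up Up; exact: Xf.
have Gr0s : Gr0 `<=` Gr.
  apply: contrapT => nsub; apply: (Gmax (Gr `|` Gr0)).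
    by split; [exact: subsetUl|move=> sub; apply: nsub => y Gy; apply: sub; right].
  by rewrite /P/= -setUA setUid.
rewrite /P/= setUidl// in hG; have [G0 GB GD Gf] := hG.
have total x : exists v, Gr (x, v).
  have [w hw] := hom_graph_adjoin x hG.
  apply: contrapT => nx.
  set B := [set p | exists k : int, Gr (p - (x, w) *~ k)] in hw.
  have GB' : Gr `<=` B by move=> p Gp; exists 0; rewrite mulr0z subr0.
  apply: (Gmax B); last by rewrite /P/= setUidl//; exact: subset_trans GB'.
  split => // BG; apply: nx; exists w; apply: BG.
  by exists 1; rewrite mulr1z subrr.
pose h' x := sval (cid (total x)).
have h'P x : Gr (x, h' x) := svalP (cid (total x)).
have h'U x v : Gr (x, v) -> h' x = v.
  move=> Gv; have := GB _ _ (h'P x) Gv.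
  by rewrite pairB subrr; move=> /Gf/eqP; rewrite subr_eq0 => /eqP.
have h'B x y : h' (x - y) = h' x - h' y.
  by apply: h'U; have := GB _ _ (h'P x) (h'P y).
exists h'; split => [x y|x|x Lx]; last by apply/h'U/Gr0s.
  have h'0 : h' 0 = 0 by have := h'B 0 0; rewrite !subrr.
  by rewrite -{1}(opprK y) -(sub0r y) h'B h'B h'0 sub0r opprK.
exact: GD (h'P x).
Qed.

End Extension.

(** A multiplicative copy of the circle: the target groups in the universal
    property of [bG] are written multiplicatively. *)
Definition mcircle (R : realType) : Type := circle R.

HB.instance Definition _ (R : realType) := Topological.copy (mcircle R) (circle R).
HB.instance Definition _ (R : realType) := @isGroup.Build (mcircle R)
  0 (-%R : circle R -> circle R) (+%R : circle R -> circle R -> circle R)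
  (@addrA (circle R)) (@add0r (circle R)) (@addr0 (circle R))
  (@addNr (circle R)) (@addrN (circle R)).

Section Mcircle.
Variable R : realType.

Let mcircle_mul : continuous (fun x : mcircle R * mcircle R => (x.1 * x.2)%g).
Proof.
move=> [s t]; apply/(@cts_circleP R) => e e0.
have e2 : 0 < e / 2 by lra.
exists ([set u : circle R | cnorm (u - s) < e / 2],
        [set u : circle R | cnorm (u - t) < e / 2]).
  by split; exact: near_circle.
move=> [s' t'] /= [hs ht].
have -> : ((s' * t')%g : circle R) - (s * t)%g = (s' - s) + (t' - t) :> circle R.
  by rewrite addrACA -opprD.
by have := cnormD (s' - s : circle R) (t' - t); lra.
Qed.

Let mcircle_inv : continuous (fun x : mcircle R => (x^-1)%g).
Proof.
move=> s; apply/(@cts_circleP R) => e e0.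
apply: filterS (near_circle (s : circle R) e0) => t h.
by rewrite -[X in cnorm X]/((- t : circle R) - - s) -opprD cnormN.
Qed.

HB.instance Definition _ :=
  PreTopologicalGroup_isTopologicalGroup.Build (mcircle R) mcircle_mul mcircle_inv.

End Mcircle.

(** * Geometrically converging sums in the circle *)

Section Sums.
Variable R : realType.
Implicit Types (e : nat -> bool) (u v : nat -> circle R) (C : R).

Definition decays u := exists C, forall n, cnorm (u n) <= C * 2^-1 ^+ n.

Definition psum e u M : circle R := \sum_(0 <= m < M | e m) u m.

(** The infinite sum over [e], singled out by a geometric rate of convergence, which makes it
    unique; 0 is the default when no element has such a rate. *)
Definition csum e u : circle R :=
  xget 0 [set t | exists C, forall M, cnorm (t - psum e u M) <= C * 2^-1 ^+ M].

Lemma psum_tail e u C M N : (forall n, cnorm (u n) <= C * 2^-1 ^+ n) ->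
  (M <= N)%N -> cnorm (psum e u N - psum e u M) <= 2 * C * 2^-1 ^+ M.
Proof.
move=> uC MN.
have C0 : 0 <= C by have := uC 0%N; rewrite expr0 mulr1; apply: le_trans; exact: cnorm_ge0.
suff : cnorm (psum e u N - psum e u M) <= 2 * C * (2^-1 ^+ M - 2^-1 ^+ N).
  move=> h; apply: le_trans h _; rewrite ler_wpM2l ?mulr_ge0// lerBlDr lerDl.
  by rewrite exprn_ge0.
elim: N MN => [|N IH].
  by rewrite leqn0 => /eqP ->; rewrite !subrr cnorm0 mulr0.
rewrite leq_eqVlt => /predU1P[->|MN]; first by rewrite !subrr cnorm0 mulr0.
have {}IH := IH MN.
have -> : psum e u N.+1 - psum e u M =
    (psum e u N - psum e u M) + (if e N then u N else 0).
  by rewrite /psum big_mkcond [in LHS]big_nat_recr//= -big_mkcond addrAC.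
apply: le_trans (cnormD _ _) _.
have : cnorm (if e N then u N else 0) <= C * 2^-1 ^+ N.
  by case: ifP => // _; rewrite cnorm0 mulr_ge0// exprn_ge0.
by rewrite exprS; lra.
Qed.

Let csum_unique e u (s t : circle R) C D :
  (forall M, cnorm (s - psum e u M) <= C * 2^-1 ^+ M) ->
  (forall M, cnorm (t - psum e u M) <= D * 2^-1 ^+ M) -> s = t.
Proof.
move=> hs ht; apply: subr0_eq; apply/cnorm_eq0/eqP.
rewrite eq_le cnorm_ge0 andbT; apply/ler_addgt0Pl => x x0; rewrite addr0.
have [M hM] := geometric_lt (C + D) x0.
have := cdistD (psum e u M) s t; rewrite (cdistC (psum e u M) t).
by have := hs M; have := ht M; lra.
Qed.

Lemma csum_tail e u C M : (forall n, cnorm (u n) <= C * 2^-1 ^+ n) ->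
  cnorm (csum e u - psum e u M) <= 2 * C * 2^-1 ^+ M.
Proof.
move=> uC.
suff [t tP] : exists t, forall M, cnorm (t - psum e u M) <= 2 * C * 2^-1 ^+ M.
  rewrite /csum; case: xgetP => [s _ [D sD]|/(_ t)]; last by case; exists (2 * C).
  by rewrite (csum_unique sD tP).
have [t [_ tcl]] := @circle_compact R (psum e u @ \oo) _ filterT.
exists t => {}M; apply/ler_addgt0Pl => x x0.
have [|_ [[N MN <-] Nt]] := tcl (psum e u @` [set N | (M <= N)%N]) _ _ (near_circle t x0).
  by exists M => // N MN; exists N.
have := cdistD (psum e u N) t (psum e u M).
have := psum_tail e uC MN; move: Nt => /=; rewrite (cdistC t (psum e u N)); lra.
Qed.

Lemma csumD e u v : decays u -> decays v -> csum e (u + v) = csum e u + csum e v.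
Proof.
move=> [C uC] [D vD].
have uvCD n : cnorm ((u + v) n) <= (C + D) * 2^-1 ^+ n.
  by apply: le_trans (cnormD _ _) _; rewrite mulrDl lerD.
apply: (@csum_unique e (u + v) _ _ _ (2 * C + 2 * D) (fun M => csum_tail e M uvCD)).
move=> M; have -> : psum e (u + v) M = psum e u M + psum e v M by rewrite /psum big_split.
rewrite opprD addrACA; apply: le_trans (cnormD _ _) _.
by have := csum_tail e M uC; have := csum_tail e M vD; lra.
Qed.

(** Sums depend continuously on [e], which later allows a countable dense family of index sets to
    stand for all of them. *)
Lemma eq_csum_prefix e e' u C M : (forall n, cnorm (u n) <= C * 2^-1 ^+ n) ->
  (forall m, (m < M)%N -> e m = e' m) ->
  cnorm (csum e u - csum e' u) <= 4 * C * 2^-1 ^+ M.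
Proof.
move=> uC ee'.
have pE : psum e u M = psum e' u M.
  rewrite /psum [LHS]big_nat_cond [RHS]big_nat_cond; apply: eq_bigl => m.
  by case: (ltnP m M) => [/ee' ->//|]; rewrite !andbF.
have := cdistD (psum e u M) (csum e u) (csum e' u).
rewrite (cdistC (psum e u M)) {2}pE.
by have := csum_tail e M uC; have := csum_tail e' M uC; lra.
Qed.

Lemma decays0 : decays 0.
Proof. by exists 0 => n; rewrite cnorm0 mul0r. Qed.

Lemma decaysB u v : decays u -> decays v -> decays (u - v).
Proof.
move=> [C uC] [D vD]; exists (C + D) => n.
by apply: le_trans (cnormB _ _) _; rewrite mulrDl lerD.
Qed.

Lemma decays_divisible u k : decays u -> (0 < k)%N ->
  exists2 v, decays v & v *+ k = u.
Proof.
move=> [C uC] k0.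
have [v vP] : {v : nat -> circle R &
    forall n, v n *+ k = u n /\ cnorm (v n) <= cnorm (u n)}.
  apply: (@choice _ _ (fun n s => s *+ k = u n /\ cnorm s <= cnorm (u n))) => n.
  by have [s sk su] := circle_root (u n) k0; exists s.
exists v; first by exists C => n; apply: le_trans (uC n); case: (vP n).
apply/funext => n; rewrite -(vP n).1.
by elim: (k) => [|j IH]; rewrite ?mulr0n// !mulrS -IH.
Qed.

End Sums.

(** * Topological groups and characters *)

(** Moves the topology of a [k_omega] neighbourhood from the subtype to [X]; relative openness in
    [K n] becomes a condition that filters in [X] itself can check. *)
Lemma locally_k_omegaP (X : topologicalType) (x : X) : locally_k_omega X ->
  exists (U : set X) (K : nat -> set X),
    [/\ open U, U x, forall n, compact (K n), forall n, K n `<=` K n.+1 &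
        \bigcup_n K n = U /\
        forall O : set X,
          (forall n y, K n y -> O y -> \forall z \near y, K n z -> O z) ->
          O x -> nbhs x O].
Proof.
move=> [_ /(_ x)[U [oU Ux [_ [K [cK KS KU Ktop]]]]]].
pose i : set_type U -> X := set_val.
have ci : continuous i by exact: initial_continuous.
exists U, (fun n => i @` K n); split => //.
- by move=> n; apply: continuous_compact; [exact: continuous_subspaceT|exact: cK].
- by move=> n _ [y Ky <-]; exists y => //; exact: KS.
split.
  apply/seteqP; split=> [_ [n _ [y _ <-]]|y Uy]; first exact: set_valP.
  have [n _ Kn] : (\bigcup_n K n) (SigSub (mem_set Uy)) by rewrite KU.
  by exists n => //; exists (SigSub (mem_set Uy)).
move=> O hO Ox.
have : open (i @^-1` O).
  apply/Ktop => n; apply/open_subspaceP.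
  exists (interior [set z | K n z -> O (i z)]).
    exact: open_interior.
  rewrite -setIA setIid; apply/seteqP; split=> y [].
    by move=> /nbhs_singleton /= h Ky; split => //; exact: h.
  move=> Oy Ky; split => //; rewrite /interior/=.
  have h : nbhs y (i @^-1` [set z | (i @` K n) z -> O z]).
    by apply: ci; apply: hO => //; exists y.
  by apply: filterS h => z /= h Kz; apply: h; exists z.
move=> [W oW WO].
rewrite nbhsE; exists (W `&` U).
  split; first exact: openI.
  split => //; suff : (i @^-1` W) (SigSub (mem_set Ux)) by [].
  by rewrite WO.
move=> y [Wy Uy].
suff : (i @^-1` O) (SigSub (mem_set Uy)) by [].
by rewrite -WO.
Qed.

Section TopologicalGroup.
Variable G : topologicalZmodType.
Implicit Types (x y : G) (A V W : set G).

Lemma cvg_sub (T : Type) (F : set_system T) (FF : Filter F) (f g : T -> G) x y :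
  f @ F --> x -> g @ F --> y -> (fun t => f t - g t) @ F --> x - y.
Proof.
move=> fx gy.
apply: (@cvg_comp _ _ _ (fun t => (f t, g t)) (fun p : G * G => p.1 - p.2)
  F _ _ _ (@sub_continuous G (x, y))).
exact: cvg_pair.
Qed.

Lemma cvg_plus (T : Type) (F : set_system T) (FF : Filter F) (f g : T -> G) x y :
  f @ F --> x -> g @ F --> y -> (fun t => f t + g t) @ F --> x + y.
Proof.
move=> fx gy.
apply: (@cvg_comp _ _ _ (fun t => (f t, g t)) (fun p : G * G => p.1 + p.2)
  F _ _ _ (@add_continuous G (x, y))).
exact: cvg_pair.
Qed.

Lemma cts_mulrn n : continuous (fun x : G => x *+ n).
Proof.
move=> x; elim: n => [|n IH]; first exact: cvg_cst.
rewrite /continuous_at mulrS (_ : (fun _ => _) = (fun x => x + x *+ n)).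
  by apply: cvg_plus => //; exact: cvg_id.
by apply/funext => y; rewrite mulrS.
Qed.

Lemma cts_subr x : continuous (fun y => y - x).
Proof. by move=> y; apply: cvg_sub; [exact: cvg_id|exact: cvg_cst]. Qed.

Lemma nbhs_addl x A : nbhs (0 : G) A -> nbhs x [set y | A (y - x)].
Proof. by move=> A0; apply: cts_subr; rewrite subrr. Qed.

Lemma nbhs_sub_split V : nbhs (0 : G) V ->
  exists2 W, nbhs (0 : G) W & forall x y, W x -> W y -> V (x - y).
Proof.
rewrite -{1}(subrr 0) => /(@sub_continuous G (0, 0))[[W1 W2] [/= h1 h2] h].
exists (W1 `&` W2); first exact: filterI.
by move=> x y [Wx _] [_ Wy]; exact: (h (x, y)).
Qed.

Definition diffs A : set G := [set p.1 - p.2 | p in A `*` A].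

Lemma compact_diffs A : compact A -> compact (diffs A).
Proof.
move=> cA; apply: continuous_compact; last exact: compact_setX.
by apply: continuous_subspaceT => p; exact: sub_continuous.
Qed.

End TopologicalGroup.

(** * Continuity and equicontinuity of characters *)

Section Characters.
Variables (R : realType) (G : topologicalZmodType).
Implicit Types (chi : G -> circle R) (x y : G) (V : set G).

Lemma morph_sub (A B : zmodType) (f : A -> B) : {morph f : x y / x + y} ->
  {morph f : x y / x - y}.
Proof. by move=> fD x y; apply: (addIr (f y)); rewrite -fD !subrK. Qed.

Lemma morph0 (A B : zmodType) (f : A -> B) : {morph f : x y / x + y} -> f 0 = 0.
Proof. by move=> /morph_sub fB; rewrite -(subrr 0) fB subrr. Qed.

Lemma morph_mulrn (A B : zmodType) (f : A -> B) n : {morph f : x y / x + y} ->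
  {morph f : x / x *+ n}.
Proof.
move=> fD x; elim: n => [|n IH]; first by rewrite !mulr0n morph0.
by rewrite !mulrS fD IH.
Qed.

(** The polar of a neighbourhood is equicontinuous: [W] consists of the points whose multiples by 1,
    2, ..., 2^k lie in [V], whatever the character. *)
Lemma equicontinuous_at0 V k : nbhs (0 : G) V ->
  exists2 W, nbhs (0 : G) W & forall chi, {morph chi : x y / x + y} ->
    (forall v, V v -> cnorm (chi v) <= 4^-1) ->
    forall w, W w -> cnorm (chi w) <= 4^-1 * 2^-1 ^+ k.
Proof.
move=> V0; exists [set w | forall j : 'I_k.+1, V (w *+ 2 ^ j)].
  have : \forall w \near (0 : G), forall j : 'I_k.+1, V (w *+ 2 ^ j); last by [].
  apply: filter_forall => j.
  by apply: (@cts_mulrn G (2 ^ j) 0); rewrite mul0rn.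
move=> chi chiD chiV w Ww; apply: cnorm_dyadic => j jk.
by rewrite -(morph_mulrn _ chiD); apply: chiV; exact: (Ww (Ordinal (jk : (j < k.+1)%N))).
Qed.

Lemma morph_continuous chi : {morph chi : x y / x + y} ->
  (forall e : R, 0 < e -> \forall x \near (0 : G), cnorm (chi x) < e) -> continuous chi.
Proof.
move=> chiD h x; apply/cts_circleP => e e0.
by apply: filterS (nbhs_addl x (h e e0)) => y /=; rewrite (morph_sub chiD).
Qed.

Lemma character_of_nbhs chi V : {morph chi : x y / x + y} -> nbhs (0 : G) V ->
  (forall v, V v -> cnorm (chi v) <= 4^-1) -> characters chi.
Proof.
move=> chiD V0 chiV; split => //; apply: morph_continuous => // e e0.
have [k ke] := geometric_lt 4^-1 e0.
have [W W0 WP] := equicontinuous_at0 k V0.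
by apply: filterS W0 => w /WP h; apply: le_lt_trans ke; exact: h.
Qed.

Lemma characterB chi psi : characters chi -> characters psi ->
  characters (fun x => chi x - psi x).
Proof.
move=> [cc cD] [pc pD]; split; last first.
  by move=> x y; rewrite cD pD opprD addrACA.
move=> x; apply/cts_circleP => e e0.
have e2 : 0 < e / 2 by lra.
have h1 := (cts_circleP _ _).1 (cc x) _ e2.
have h2 := (cts_circleP _ _).1 (pc x) _ e2.
apply: filterS2 h1 h2 => y h1 h2.
by rewrite subrACA; have := cnormB (chi y - chi x) (psi y - psi x); lra.
Qed.

Lemma characterMn chi n : characters chi -> characters (fun x => chi x *+ n).
Proof.
move=> [cc cD]; have D : {morph (fun x => chi x *+ n) : x y / x + y}.
  by move=> x y; rewrite cD mulrnDl.
split => //; apply: morph_continuous => // e e0.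
have e' : 0 < e / n.+1%:R by rewrite divr_gt0.
apply: filterS ((cts_circleP _ _).1 (cc 0) _ e') => x; rewrite (morph0 cD) subr0 => h.
apply: le_lt_trans (cnormMn _ _) _.
rewrite ltr_pdivlMr// mulrC in h; apply: le_lt_trans h.
by rewrite ler_wpM2r ?cnorm_ge0// ler_nat.
Qed.

Lemma locally_quasiconvex_separates : hausdorff_space G -> locally_quasiconvex R G ->
  forall x, x != 0 -> exists2 chi : G -> circle R, characters chi & chi x != 0.
Proof.
move=> hG lqc x x0.
have U0 : nbhs (0 : G) (~` [set x]).
  apply: open_nbhs_nbhs; split; last by move=> /= /esym/eqP; exact/negP.
  by rewrite openC; exact/accessible_closed_set1/hausdorff_accessible.
have [V [V0 VU qV]] := lqc _ U0.
have : ~ V x by move=> /VU; exact.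
rewrite -qV => /existsNP[chi /not_implyP[[chiC _] nx]].
exists chi => //; apply: contra_notN nx => /eqP ->.
by rewrite -/(cnorm _) cnorm0 invr_ge0.
Qed.

End Characters.

(** * Hulls of compact sets *)

Section UltraLimit.
Variables (R : realType) (T : Type) (U : set_system T).
Hypothesis UU : UltraFilter U.

Lemma ultra_circle_cvg (f : T -> circle R) :
  exists l, forall e : R, 0 < e -> \forall t \near U, cnorm (f t - l) < e.
Proof.
have [l [_ lcl]] := @circle_compact R (f @ U) _ filterT.
exists l => e e0.
have [//|Uc] := in_ultra_setVsetC [set t | cnorm (f t - l) < e] UU.
have /= [|_ [[t nt <-] /= ft]] := lcl (f @` ~` [set t | cnorm (f t - l) < e]) _ _ (near_circle l e0).
  by apply: filterS Uc => t; exists t.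
by case: nt.
Qed.

Definition ulim (f : T -> circle R) : circle R := sval (cid (ultra_circle_cvg f)).

Lemma ulimP f (e : R) : 0 < e -> \forall t \near U, cnorm (f t - ulim f) < e.
Proof. exact: (svalP (cid (ultra_circle_cvg f))). Qed.

Lemma ulim_unique f l : (forall e : R, 0 < e -> \forall t \near U, cnorm (f t - l) < e) ->
  ulim f = l.
Proof.
move=> h; apply: subr0_eq; apply/cnorm_eq0/eqP.
rewrite eq_le cnorm_ge0 andbT; apply/ler_addgt0Pl => e e0; rewrite addr0.
have e2 : 0 < e / 2 by lra.
have [t [h1 h2]] := filter_ex (filterI (h _ e2) (ulimP f e2)).
by have := cdistD (f t) (ulim f) l; rewrite (cdistC (ulim f) (f t)); lra.
Qed.

End UltraLimit.

Section Ascoli.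
Variables (R : realType) (G : topologicalZmodType) (T : Type) (U : set_system T).
Hypothesis UU : UltraFilter U.
Variables (V : set G) (F : T -> G -> circle R).
Hypothesis V0 : nbhs (0 : G) V.
Hypothesis FV : forall t, polar V (F t).

Let Fl x := ulim UU (fun t => F t x).

Let FlD : {morph Fl : x y / x + y}.
Proof.
move=> x y; apply: ulim_unique => e e0; have e2 : 0 < e / 2 by lra.
apply: filterS2 (ulimP UU (fun t => F t x) e2) (ulimP UU (fun t => F t y) e2) => t hx hy.
have [[_ FD] _] := FV t; rewrite FD opprD addrACA.
by have := cnormD (F t x - Fl x) (F t y - Fl y); rewrite /Fl; lra.
Qed.

Lemma polar_ulim : polar V Fl.
Proof.
have h v : V v -> cnorm (Fl v) <= 4^-1.
  move=> Vv; apply/ler_addgt0Pl => e e0.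
  have [t ht] := filter_ex (ulimP UU (fun t => F t v) e0).
  have [_ /(_ v Vv)] := FV t; rewrite -/(cnorm _).
  by have := cnorm_distB (Fl v) (F t v); rewrite cdistC /Fl; lra.
by split; [exact: (character_of_nbhs FlD V0)|exact: h].
Qed.

(** By equicontinuity, pointwise convergence along [U] is uniform on compact sets: points [k t]
    where it fails would cluster at some [y], where convergence is known. *)
Let ascoli (K : set G) (e : R) : compact K -> 0 < e ->
  \forall t \near U, forall x, K x -> cnorm (F t x - Fl x) <= e.
Proof.
move=> cK e0.
set B := [set t | forall x, K x -> cnorm (F t x - Fl x) <= e].
have [//|Uc] := in_ultra_setVsetC B UU.
have kP t : exists x, (~` B) t -> K x /\ e < cnorm (F t x - Fl x).
  have [Bt|/existsNP[x /not_implyP[Kx /negP h]]] := pselect (B t); first by exists 0.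
  by exists x => _; rewrite ltNge.
have {kP} [k kP] := choice kP.
have Fk : U (k @^-1` K) by apply: filterS Uc => t nt; exact: (kP t nt).1.
have [y [Ky ycl]] := cK (k @ U) _ Fk.
have e4 : 0 < e / 4 by lra.
have [j je] := geometric_lt 4^-1 e4.
have [W W0 WP] := equicontinuous_at0 R j V0.
pose A := ~` B `&` [set t | cnorm (F t y - Fl y) < e / 4].
have UA : U A by apply: filterI => //; exact: (ulimP UU (fun t => F t y)).
have UkA : U (k @^-1` (k @` A)) by apply: filterS UA => t At; exists t.
have [_ [[t [Bt /= hy] <-] Wt]] := ycl (k @` A) _ UkA (nbhs_addl y W0).
have [Kt] := kP t Bt.
have [[_ FD] FVt] := FV t; have [[_ _] FlV] := polar_ulim.
have h1 := WP (F t) FD FVt _ Wt; have h2 := WP Fl FlD FlV _ Wt.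
have -> : F t (k t) - Fl (k t) = (F t (k t - y) - Fl (k t - y)) + (F t y - Fl y).
  by rewrite (morph_sub FD) (morph_sub FlD) subrACA subrK.
have := cnormD (F t (k t - y) - Fl (k t - y)) (F t y - Fl y).
by have := cnormB (F t (k t - y)) (Fl (k t - y)); lra.
Qed.

(** Once [F t - Fl] is at most [2^-k / 4] on [K], its multiples by [2^j], [j <= k], lie in the polar
    of [K], so they are at most 1/4 on the hull and the dyadic bound applies there. *)
Lemma ascoli_hull (K : set G) (e : R) : compact K -> 0 < e ->
  \forall t \near U, forall x, prepolar (polar K : set (G -> circle R)) x ->
    cnorm (F t x - Fl x) <= e.
Proof.
move=> cK e0; have [k ke] := geometric_lt 4^-1 e0.
have e' : 0 < 4^-1 * 2^-1 ^+ k * 4^-1 :> R by rewrite !mulr_gt0// exprn_gt0.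
have e2 : 0 < 4^-1 * 2^-1 ^+ k :> R by rewrite !mulr_gt0// exprn_gt0.
apply: filterS (ascoli cK e2) => t ht x hx.
have dC : characters (fun x => F t x - Fl x).
  by apply: characterB; [have [] := FV t|have [] := polar_ulim].
apply: le_trans (ltW ke); apply: cnorm_dyadic => j jk.
apply: (hx (fun x => (F t x - Fl x) *+ 2 ^ j)); split; first exact: characterMn.
move=> y Ky; apply: le_trans (cnormMn _ _) _.
have jk2 : (2 ^ j)%:R * 2^-1 ^+ k <= 1 :> R.
  by rewrite natrX exprVn ler_pdivrMr ?exprn_gt0// mul1r ler_eXn2l ?ltr1n.
have := ler_wpM2l (ler0n R (2 ^ j)) (ht y Ky).
by move=> h; apply: le_trans h _; rewrite mulrCA ler_piMr// invr_ge0.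
Qed.

End Ascoli.

(* The hull of a compact set is precompact: by Ascoli, a double ultralimit of
   characters witnessing a separation would contradict itself. *)
Lemma hull_no_separated (R : realType) (G : topologicalZmodType) (K V : set G)
    (b : nat -> G) :
  compact K -> nbhs (0 : G) V -> quasiconvex R V ->
  (forall n, prepolar (polar K : set (G -> circle R)) (b n)) ->
  exists i n, (i < n)%N /\ V (b n - b i).
Proof.
move=> cK V0 qV bK; apply: contrapT => nV.
have polar0 : polar V (fun _ : G => 0 : circle R).
  split; last by move=> v _; rewrite -/(cnorm _) cnorm0 invr_ge0.
  split; first by move=> x; exact: cvg_cst.
  by move=> x y; rewrite addr0.
have XP (p : nat * nat) : exists chi : G -> circle R,
    polar V chi /\ ((p.1 < p.2)%N -> 4^-1 < cnorm (chi (b p.2 - b p.1))).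
  have [lt|ge] := ltnP p.1 p.2; last by exists (fun=> 0).
  have : ~ prepolar (polar V : set (G -> circle R)) (b p.2 - b p.1).
    by rewrite qV => h; apply: nV; exists p.1, p.2.
  move=> /existsNP[chi /not_implyP[chiV /negP h]].
  by exists chi; split => // _; rewrite ltNge.
have {XP} [X XP] := choice XP.
(* [U] contains the tails, so a fixed [i] is below almost all [n]. The limit is taken first in [n],
   at a cost of 1/32 at each of two points: 1/4 - 2/32 = 3/16. *)
have [U [UU Uoo]] := ultraFilterLemma eventually_filter.
pose chi_ i x := ulim UU (fun n => X (i, n) x).
have chi_V i : polar V (chi_ i) by apply: polar_ulim => // n; case: (XP (i, n)).
have e32 : 0 < 32^-1 :> R by rewrite invr_gt0.
have h1 i : \forall n \near U, 3 / 16 <= cnorm (chi_ i (b n) - chi_ i (b i)).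
  have XV n : polar V (X (i, n)) by case: (XP (i, n)).
  have Ui : U [set n | (i < n)%N] by apply: Uoo; exists i.+1.
  apply: filterS2 Ui (ascoli_hull UU V0 XV cK e32) => n lt h.
  have [_ /(_ lt) /=] := XP (i, n).
  have [[_ XD] _] := XV n; rewrite (morph_sub XD).
  have := h _ (bK n); have := h _ (bK i); rewrite -!/(chi_ _ _).
  have := cdistD (chi_ i (b n)) (X (i, n) (b n)) (X (i, n) (b i)).
  have := cdistD (chi_ i (b i)) (chi_ i (b n)) (X (i, n) (b i)).
  by rewrite (cdistC (chi_ i (b i))); lra.
pose chi x := ulim UU (fun i => chi_ i x).
pose beta := ulim UU (fun n => chi (b n)).
have h2 : \forall i \near U, 2 / 32 < cnorm (beta - chi (b i)).
  apply: filterS (ascoli_hull UU V0 chi_V cK e32) => i h.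
  have [n [hn1 hn2]] := filter_ex (filterI (h1 i) (ulimP UU (fun n => chi (b n)) e32)).
  have := h _ (bK n); have := h _ (bK i); rewrite -!/(chi _) => hi hn.
  have := cdistD (chi (b n)) (chi_ i (b n)) (chi_ i (b i)).
  have := cdistD (chi (b i)) (chi (b n)) (chi_ i (b i)).
  have := cdistD beta (chi (b n)) (chi (b i)).
  rewrite (cdistC (chi (b i))) /beta; move: hn1 hn2 => /=; lra.
have [i [hi1 hi2]] := filter_ex (filterI h2 (ulimP UU (fun n => chi (b n)) e32)).
by move: hi1 hi2 => /=; rewrite cdistC /beta; lra.
Qed.

(** * A filtration by compact sets *)

Section Filtration.
Variables (G : topologicalZmodType) (K : nat -> set G).
Implicit Types (f : nat -> G) (x y : G) (n : nat).

(** The sets L_n. Two rounds of differences of a set containing 0 yield sums as well. The sequence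
    [f] adjoins extra elements to the group; [f = 0] gives H. *)
Fixpoint filtration f n : set G :=
  if n is m.+1 then diffs (diffs (filtration f m `|` K m `|` [set f m]))
  else [set 0].

Let diffs_sub (A : set G) : A 0 -> A `<=` diffs A.
Proof. by move=> A0 x Ax; exists (x, 0) => //=; rewrite subr0. Qed.

Let diffs0 (A : set G) : A 0 -> diffs A 0.
Proof. by move=> A0; exact: diffs_sub. Qed.

Lemma filtration0 f n : filtration f n 0.
Proof. by elim: n => [//|n IH]; apply/diffs0/diffs0; left; left. Qed.

Let step f n : filtration f n `|` K n `|` [set f n] `<=` filtration f n.+1.
Proof.
have h0 : (filtration f n `|` K n `|` [set f n]) 0 by left; left; exact: filtration0.
by apply: subset_trans (diffs_sub h0) _; exact/diffs_sub/diffs0.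
Qed.

Lemma filtrationS f n : filtration f n `<=` filtration f n.+1.
Proof. by move=> x Lx; apply: step; left; left. Qed.

Lemma filtration_le f m n : (m <= n)%N -> filtration f m `<=` filtration f n.
Proof.
elim: n => [|n IH]; first by rewrite leqn0 => /eqP ->.
rewrite leq_eqVlt => /predU1P[->//|/IH h].
exact: subset_trans h (@filtrationS f n).
Qed.

Lemma filtrationK f n : K n `<=` filtration f n.+1.
Proof. by move=> x Lx; apply: step; left; right. Qed.

Lemma filtration_mem f n : filtration f n.+1 (f n).
Proof. by apply: step; right. Qed.

Lemma filtrationB f n x y : filtration f n x -> filtration f n y ->
  filtration f n.+1 (x - y).
Proof.
move=> Lx Ly; have h0 : (filtration f n `|` K n `|` [set f n]) 0.
  by left; left; exact: filtration0.
apply: diffs_sub; first exact: diffs0.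
by exists (x, y) => //; split; left; left.
Qed.

Lemma filtrationD f n x y : filtration f n x -> filtration f n y ->
  filtration f n.+1 (x + y).
Proof.
move=> Lx Ly; have h0 : (filtration f n `|` K n `|` [set f n]) 0.
  by left; left; exact: filtration0.
exists (x, - y); last by rewrite /= opprK.
split; first by apply: diffs_sub => //; left; left.
by exists (0, y); [split => //; left; left|rewrite /= sub0r].
Qed.

Lemma filtration_mul2n f n k x : filtration f n x -> filtration f (n + k) (x *+ 2 ^ k).
Proof.
move=> Lx; elim: k => [|k IH]; first by rewrite addn0.
by rewrite addnS expnSr mulrnA mulr2n; exact: filtrationD.
Qed.

Lemma filtration_mono f n : filtration (fun=> 0) n `<=` filtration f n.
Proof.
have diffsS (A B : set G) : A `<=` B -> diffs A `<=` diffs B.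
  by move=> AB _ [p [/AB h1 /AB h2] <-]; exists p.
elim: n => [//|n IH]; apply/diffsS/diffsS => x [[/IH Lx|Kx]|->]; left.
- by left.
- by right.
- by left; exact: filtration0.
Qed.

Hypothesis cK : forall n, compact (K n).

Lemma filtration_compact f n : compact (filtration f n).
Proof.
elim: n => [|n IH]; first exact: compact_set1.
by apply/compact_diffs/compact_diffs/compactU; [exact: compactU|exact: compact_set1].
Qed.

Definition span f := \bigcup_n filtration f n.

Lemma span0 f : span f 0.
Proof. by exists 0%N => //; exact: filtration0. Qed.

Lemma spanB f x y : span f x -> span f y -> span f (x - y).
Proof.
move=> [m _ Lx] [n _ Ly]; exists (maxn m n).+1 => //.
by apply: filtrationB; apply: filtration_le; [exact: leq_maxl| |exact: leq_maxr|].
Qed.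

Lemma spanD f x y : span f x -> span f y -> span f (x + y).
Proof.
move=> Lx Ly; rewrite -(opprK y) -(sub0r y).
by apply: spanB => //; apply: spanB => //; exact: span0.
Qed.

Lemma span_mem f n : span f (f n).
Proof. by exists n.+1 => //; exact: filtration_mem. Qed.

Lemma sub_span f : \bigcup_n K n `<=` span f.
Proof. by move=> x [n _ Kx]; exists n.+1 => //; exact: filtrationK. Qed.

End Filtration.

(** Neighbourhoods of 0 can thus be recognised on the compact sets [K n], where uniform estimates
    are available. *)
Definition k_omega_nbhs0 (G : topologicalZmodType) (K : nat -> set G) :=
  [/\ forall n, compact (K n), nbhs (0 : G) (\bigcup_n K n) &
      forall O : set G,
        (forall n y, K n y -> O y -> \forall z \near y, K n z -> O z) ->
        O 0 -> nbhs (0 : G) O].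

Section Bounded.
Variables (R : realType) (G : topologicalZmodType) (K : nat -> set G).
Hypothesis hG : hausdorff_space G.
Hypothesis lqG : locally_quasiconvex R G.
Hypothesis KG : k_omega_nbhs0 K.
Variable f : nat -> G.
Local Notation L := (filtration K f).

(* Otherwise [A] contains a sequence [b] such that every [L n] contains only
   finitely many of the differences [b n - b i], [i < n]; these differences then
   miss a neighbourhood of [0]. *)
Lemma hull_sub_filtration (A C : set G) : A `<=` span K f -> compact C ->
  A `<=` prepolar (polar C : set (G -> circle R)) -> exists n, A `<=` L n.
Proof.
move=> AL cC AC; apply: contrapT => nA.
have pickP n : exists a, A a /\ ~ L n a.
  apply: contrapT => h; apply: nA; exists n => a Aa; apply: contrapT => La.
  by apply: h; exists a.
have [pick pickA] := choice pickP.
have levP n : exists m, L m (pick n).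
  by have [m _ Lm] := AL _ (pickA n).1; exists m.
have [lev levL] := choice levP.
(* For [i < n], [b i] lies in [L (lev (m i))] with [lev (m i) < m n], but [b n] avoids [L (m n)].
   The successor leaves room for adding [b n - b i] and [b i]. *)
pose m := fix m n := if n is k.+1 then (maxn (m k) (maxn k.+1 (lev (m k)))).+1 else 0%N.
pose b n := pick (m n).
have mS n : (m n.+1 = (maxn (m n) (maxn n.+1 (lev (m n)))).+1)%N by [].
have m_le i n : (i <= n)%N -> (m i <= m n)%N.
  elim: n => [|n IH]; first by rewrite leqn0 => /eqP ->.
  rewrite leq_eqVlt => /predU1P[->//|/IH h]; rewrite mS; lia.
have bP i n : (i < n)%N -> ~ L n (b n - b i).
  move=> lt h; apply: (pickA (m n)).2; rewrite -/(b n) -(subrK (b i) (b n)).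
  have mi := m_le _ _ lt.
  have mn : (n.+1 <= m n)%N by case: (n) lt => // k _; rewrite mS; lia.
  apply: (@filtration_le _ _ _ (maxn n (lev (m i))).+1); first by rewrite mS in mi; lia.
  apply: filtrationD.
    by apply: filtration_le h; exact: leq_maxl.
  by apply: filtration_le (levL (m i)); exact: leq_maxr.
pose O := [set x | forall i n, (i < n)%N -> x != b n - b i].
have O0 : nbhs (0 : G) O.
  have [_ _] := KG; apply; last first.
    move=> i n lt; apply/eqP => E; apply: (bP i n lt); rewrite -E; exact: filtration0.
  (* As [K n] lies in [L n.+1], only differences [b k - b i] with [k <= n] can lie in it: finitely
     many points, closed in a Hausdorff group. *)
  move=> n y Ky Oy.
  have : \forall z \near y, forall p : 'I_n.+1 * 'I_n.+1, (p.1 < p.2)%N -> z != b p.2 - b p.1.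
    apply: filter_forall => p.
    have [lt|ge] := ltnP p.1 p.2; last exact: nearW.
    have yp : y != b p.2 - b p.1 by exact: Oy.
    have /accessible_closed_set1/(_ (b p.2 - b p.1)) := hausdorff_accessible hG.
    rewrite -openC openE => /(_ y) /= h.
    by apply: filterS (h _); [move=> z /eqP nz _|exact/eqP].
  apply: filterS => z h Kz i k lt.
  have [kn|nk] := ltnP k n.+1.
    have ik : (i < n.+1)%N by exact: ltn_trans kn.
    exact: (h (Ordinal ik, Ordinal kn)).
  apply/eqP => E; apply: (bP i k lt); rewrite -E.
  by apply: filtration_le nk _ _; exact: filtrationK.
have [V [V0 VO qV]] := lqG O0.
have [i [n [lt /VO /(_ i n lt)]]] := hull_no_separated cC V0 qV (fun n => AC _ (pickA (m n)).1).
by rewrite eqxx.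
Qed.

End Bounded.

(** * The gliding hump *)

Section Hump.
Variable R : realType.

Lemma sum_geometric_le n : \sum_(0 <= m < n) 2^-1 ^+ m <= 2 :> R.
Proof.
suff -> : \sum_(0 <= m < n) 2^-1 ^+ m = 2 - 2 * 2^-1 ^+ n :> R.
  by rewrite lerBlDr lerDl mulr_ge0// exprn_ge0.
elim: n => [|n IH]; first by rewrite big_nil expr0 mulr1 subrr.
by rewrite big_nat_recr//= IH exprS; lra.
Qed.

(* Between [q] and [r] the sum over [e] changes essentially by the term of index
   [r]: the terms below [p] have almost converged and those beyond [s] are small. *)
Lemma gliding_hump (u : nat -> nat -> circle R) (C : nat -> R) (lam : nat -> circle R)
    (e : nat -> bool) (p q r s : nat) :
  (forall n m, cnorm (u m n) <= C n * 2^-1 ^+ m) ->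
  (q < r < s)%N ->
  (forall m, (m <= p)%N -> cnorm (u m q - lam m) <= 2^-1 ^+ m / 256) ->
  (forall m, (m <= p)%N -> cnorm (u m r - lam m) <= 2^-1 ^+ m / 256) ->
  2 * C q * 2^-1 ^+ r <= 64^-1 -> 2 * C r * 2^-1 ^+ s <= 64^-1 ->
  (forall m, e m -> [\/ (m <= p)%N, m = r | (s <= m)%N]) ->
  cnorm (csum e (u^~ r) - csum e (u^~ q) - (if e r then u r r else 0)) <= 5 / 64.
Proof.
move=> uC /andP[qr rs] hq hr Cq Cr supp.
have Cq0 : 0 <= C q by have := uC q 0%N; rewrite expr0 mulr1; apply: le_trans; exact: cnorm_ge0.
have Cqs : 2 * C q * 2^-1 ^+ s <= 64^-1.
  apply: le_trans Cq; rewrite ler_wpM2l ?mulr_ge0// ler_wiXn2l//; first lra.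
  exact: ltnW.
(* Terms up to [p] contribute at most 2/128 to [D], and [u r q] at most 1/128; the two tails from
   [s] on add at most 1/64 each. *)
pose D := \sum_(0 <= m < s)
  (if e m then u m r - u m q - (if m == r then u r r else 0) else 0).
have DE : psum e (u^~ r) s - psum e (u^~ q) s - (if e r then u r r else 0) = D.
  rewrite /D -big_mkcond /= sumrB sumrB /psum; congr (_ - _).
  by rewrite -big_mkcondr/= big_nat1_cond_eq rs.
have Dle : cnorm D <= 3 / 128.
  apply: le_trans (cnorm_sum _ _ _) _.
  apply: (@le_trans _ _ (\sum_(0 <= m < s)
    (2^-1 ^+ m * 128^-1 + (if m == r then 128^-1 else 0)))).
    apply: ler_sum_nat => m /andP[_ ms].
    have g0 : 0 <= 2^-1 ^+ m :> R by rewrite exprn_ge0.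
    have [em|_] := boolP (e m); last first.
      by rewrite cnorm0; case: ifP => _; lra.
    have [mp|mr|] := supp _ em; last by rewrite leqNgt ms.
    - have [mr|_] := eqVneq m r.
        rewrite mr addrAC subrr sub0r cnormN in g0 *.
        by have := uC q r; lra.
      rewrite subr0 addr0.
      have := cdistD (lam m) (u m r) (u m q); rewrite (cdistC (lam m)).
      by have := hq _ mp; have := hr _ mp; lra.
    - rewrite mr eqxx addrAC subrr sub0r cnormN.
      have := uC q r; have : 0 <= 2^-1 ^+ r :> R by rewrite exprn_ge0.
      lra.
  rewrite big_split/= -mulr_suml -big_mkcond/= big_nat1_eq rs/=.
  by have := sum_geometric_le s; lra.
have := csum_tail e s (uC r); have := csum_tail e s (uC q).
set a := csum _ _; set b := psum _ _ _; set a' := csum _ _; set b' := psum _ _ _ => h h'.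
have -> : a' - a - (if e r then u r r else 0) = (a' - b') - (a - b) + D.
  by rewrite -DE -/b -/b' (subrACA a') addrA subrK.
have := cnormD ((a' - b') - (a - b)) D; have := cnormB (a' - b') (a - b).
lra.
Qed.

End Hump.

(** * Null sequences of characters *)

Section NullSequences.
Variables (R : realType) (G : topologicalZmodType) (K : nat -> set G).
Hypothesis KG : k_omega_nbhs0 K.
Variable f : nat -> G.
Local Notation L := (filtration K f).

(** For [x] in [L m], the multiples [2^j x] with [j <= n - m] lie in [L n], where [chi n] is at most
    1/4. *)
Lemma polar_filtration_decay (chi : nat -> G -> circle R) m n x :
  (forall n, polar (L n) (chi n)) -> L m x ->
  cnorm (chi n x) <= 2 ^+ m * 2^-1 ^+ n.
Proof.
move=> chiL Lx; have [mn|nm] := leqP m n; last first.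
  apply: le_trans (cnorm_le_half _) _; rewrite exprVn ler_pdivlMr ?exprn_gt0//.
  apply: (@le_trans _ _ (2 ^+ n)); first by rewrite ler_piMl ?exprn_ge0//; lra.
  by rewrite ler_weXn2l ?ler1n//; exact: ltnW.
have [[_ chiD] chi4] := chiL n.
have : cnorm (chi n x) <= 4^-1 * 2^-1 ^+ (n - m).
  apply: cnorm_dyadic => j jn; rewrite -(morph_mulrn _ chiD); apply: chi4.
  apply: (@filtration_le _ _ _ (m + j)); first by rewrite -leq_subRL.
  exact: filtration_mul2n.
move=> h; apply: le_trans h _.
have -> : 2 ^+ m * 2^-1 ^+ n = 2^-1 ^+ (n - m) :> R.
  rewrite -{1}(subnKC mn) exprD mulrA -exprMn divff// ?expr1n ?mul1r//.
by rewrite ler_piMl ?exprn_ge0//; lra.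
Qed.

(* Outside [span f] the characters [chi n] need not tend to [0], but decaying
   sequences in the circle form a divisible group. *)
Lemma null_sequence_extension (chi : nat -> G -> circle R) :
  (forall n, polar (L n) (chi n)) ->
  exists Th : nat -> G -> circle R,
    [/\ forall n, characters (Th n),
        forall g, decays (fun n => Th n g) &
        forall n x, span K f x -> Th n x = chi n x].
Proof.
move=> chiL; pose h x : nat -> circle R := fun n => chi n x.
have [h' [h'D h'dec h'h]] : exists h' : G -> nat -> circle R,
    [/\ {morph h' : x y / x + y}, forall x, decays (h' x) &
        forall x, span K f x -> h' x = h x].
  apply: hom_extension; [exact: decays0|exact: decaysB|exact: decays_divisible|
    exact: span0|exact: spanB| |].
  - by move=> x [m _ Lx]; exists (2 ^+ m) => n; exact: polar_filtration_decay.
  - move=> x y _ _; apply/funext => n; have [[_ chiD] _] := chiL n.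
    by rewrite /h (morph_sub chiD).
exists (fun n x => h' x n); split=> [n|//|n x Lx]; last by rewrite h'h.
have hD : {morph (fun x => h' x n) : x y / x + y} by move=> x y; rewrite h'D.
split=> //; apply: morph_continuous => // e e0.
have [[cchi chiD] _] := chiL n.
have [_ K0 _] := KG.
have := (cts_circleP _ _).1 (cchi 0) e e0; rewrite (morph0 chiD).
apply: filterS2 K0 => x /(@sub_span _ K f) Lx.
by rewrite subr0 h'h.
Qed.

(** On each [K n], a part of [L n.+1], the partial sums converge uniformly; since neighbourhoods of
    0 are tested on the [K n], the sum is continuous. *)
Lemma csum_character (Th : nat -> G -> circle R) (e : nat -> bool) :
  (forall n, characters (Th n)) -> (forall g, decays (fun n => Th n g)) ->
  (forall m n x, L m x -> cnorm (Th n x) <= 2 ^+ m * 2^-1 ^+ n) ->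
  characters (fun x => csum e (fun n => Th n x)).
Proof.
move=> Thc Thd ThL; set chi := fun x => _.
have chiD : {morph chi : x y / x + y}.
  move=> x y; rewrite /chi -csumD//; congr csum; apply/funext => n.
  by have [_ ThD] := Thc n; rewrite ThD.
have Sc M : characters (fun x => psum e (fun n => Th n x) M).
  elim: M => [|M IH].
    rewrite (_ : (fun=> _) = fun=> 0).
      by split; [move=> x; exact: cvg_cst|move=> x y; rewrite addr0].
    by apply/funext => x; rewrite /psum big_nil.
  rewrite (_ : (fun=> _) = fun x => psum e (fun n => Th n x) M -
      (fun x => (if e M then - Th M x else 0)) x); last first.
    apply/funext => x; rewrite /psum big_mkcond big_nat_recr//= -big_mkcond; congr (_ + _).
    by case: ifP => _; rewrite ?opprK ?subr0 ?oppr0.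
  apply: characterB => //; case: (e M); last first.
    by split; [move=> x; exact: cvg_cst|move=> x y; rewrite addr0].
  have c0 : characters (fun _ : G => 0 : circle R).
    by split; [move=> x; exact: cvg_cst|move=> x y; rewrite addr0].
  have := characterB c0 (Thc M).
  by under eq_fun do rewrite sub0r.
split=> //; apply: morph_continuous => // d d0.
have [_ _] := KG; apply; last by rewrite /= (morph0 chiD) cnorm0.
move=> n y Ky /= yd.
have e0 : 0 < (d - cnorm (chi y)) / 3 by lra.
have [M hM] := geometric_lt (2 * 2 ^+ n.+1) e0.
have := (cts_circleP _ _).1 ((Sc M).1 y) _ e0.
apply: filterS => z zy Kz.
have hy := csum_tail e M (fun k => ThL _ k _ (@filtrationK _ K f n y Ky)).
have hz := csum_tail e M (fun k => ThL _ k _ (@filtrationK _ K f n z Kz)).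
have := cnorm_distB (chi z) (chi y).
have := cdistD (psum e (fun n => Th n z) M) (chi z) (chi y).
have := cdistD (psum e (fun n => Th n y) M) (psum e (fun n => Th n z) M) (chi y).
rewrite (cdistC (psum e (fun n => Th n y) M) (chi y)) -/(chi y) -/(chi z) in hy hz *.
rewrite /chi in hy hz *; lra.
Qed.

End NullSequences.

(** * Clustering along characters, and countability *)

Section CharacterFamilies.
Variables (R : realType) (G : topologicalZmodType).
Implicit Types (S : set (G -> circle R)) (A : set G).

(** A common weakening of functional boundedness of [A] in [G^+] (with [S] all
    characters) and of compactness of [b_N(A)] (with [S] the characters whose
    extension to [bG] vanishes on [N]). *)
Definition countably_clusters S A :=
  forall (x : nat -> G) (psi : nat -> G -> circle R),
    (forall n, A (x n)) -> (forall i, S (psi i)) ->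
    exists g, forall M N (e : R), 0 < e ->
      exists n, (N <= n)%N /\ forall i, (i < M)%N -> cnorm (psi i (x n) - psi i g) < e.

(** The fibres of [c] play the role of the cosets of a subgroup [S]. *)
Definition countable_index S :=
  exists c : (G -> circle R) -> nat, forall chi psi,
    characters chi -> characters psi -> c chi = c psi -> S (fun x => chi x - psi x).

End CharacterFamilies.

(** The 2-adic valuation of [j + 1] takes every value infinitely often, so each bit of a sequence
    can be tested at infinitely many humps. *)
Lemma infinite_fibers : exists fold : nat -> nat,
  forall l N, exists j, (N <= j)%N /\ fold j = l.
Proof.
exists (fun j => logn 2 j.+1) => l N.
exists (2 ^ l * (2 * N + 1)).-1; split.
  have : (0 < 2 ^ l)%N by rewrite expn_gt0.
  nia.
rewrite prednK ?muln_gt0 ?expn_gt0 ?addn1//.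
rewrite lognM ?expn_gt0// pfactorK// [X in (_ + X)%N]lognE dvdn2 /= oddM /=.
by rewrite addn0.
Qed.

(** Cantor's diagonal argument as a pigeonhole principle, to be applied to the classes of
    uncountably many sums. *)
Lemma cantor_collision (c : (nat -> bool) -> nat) : exists a a', a <> a' /\ c a = c a'.
Proof.
apply: contrapT => h.
have inj a a' : c a = c a' -> a = a'.
  by move=> aa'; apply: contrapT => naa'; apply: h; exists a, a'.
pose D : nat -> bool := fun n => `[< exists a, c a = n /\ ~~ a n >].
have [|nD] := boolP (D (c D)).
  by move=> Dc; have /asboolP[a [/inj -> /negP]] := Dc.
by have /asboolP := nD; apply; exists D.
Qed.

Section PairDensity.
Let pair := ((nat -> bool) * (nat -> bool))%type.

(* For each finite pattern that begins some member of [D], choose one such member. *)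
Lemma pairs_separable (D : set pair) : D !=set0 ->
  exists d : nat -> pair, (forall i, D (d i)) /\
    forall P M, D P -> exists i, forall m, (m < M)%N ->
      (d i).1 m = P.1 m /\ (d i).2 m = P.2 m.
Proof.
move=> [P0 DP0].
pose prefix (P : pair) M := [seq (P.1 m, P.2 m) | m <- iota 0 M].
have dP (s : seq (bool * bool)) : exists P, D P /\
    forall Q, D Q -> prefix Q (size s) = s -> prefix P (size s) = s.
  have [[Q [DQ Qs]]|nQ] := pselect (exists Q, D Q /\ prefix Q (size s) = s).
    by exists Q.
  by exists P0; split => // Q DQ Qs; case: nQ; exists Q.
have [d {}dP] := choice dP.
exists (fun i => d (odflt [::] (unpickle i))); split=> [i|P M DP].
  by have [] := dP (odflt [::] (unpickle i)).
exists (pickle (prefix P M)) => m mM; rewrite pickleK /=.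
have sM : size (prefix P M) = M by rewrite size_map size_iota.
have [_ /(_ P DP)] := dP (prefix P M); rewrite sM => /(_ erefl).
move=> /(congr1 (fun s => nth (false, false) s m)).
rewrite !(nth_map 0%N) ?size_iota// nth_iota// add0n.
by case.
Qed.

End PairDensity.

(** * Containment in the hull of a filtration step *)

Section CoreHull.
Variables (R : realType) (G : topologicalZmodType) (K : nat -> set G).
Hypothesis KG : k_omega_nbhs0 K.
Variables (f : nat -> G) (S : set (G -> circle R)) (A : set G).
Local Notation L := (filtration K f).
Hypothesis AL : A `<=` span K f.
Hypothesis SA : countably_clusters S A.
Hypothesis Sindex : countable_index S.

(** If [A] escapes every hull, some difference [Psi P] in [S] stays away from its value at a point
    [g] along a subsequence, although this subsequence has a cluster point that such differences
    cannot tell from [g]. *)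
Lemma sub_hull_filtration : exists n, A `<=` prepolar (polar (L n) : set (G -> circle R)).
Proof.
apply: contrapT => nA.
have : forall n, exists p : G * (G -> circle R),
    [/\ A p.1, polar (L n) p.2 & 4^-1 < cnorm (p.2 p.1)].
  move=> n; apply: contrapT => h; apply: nA; exists n => x Ax chi chiL.
  by rewrite leNgt; apply/negP => lt; apply: h; exists (x, chi).
move=> /choice[p pP].
pose x n := (p n).1; pose chi n := (p n).2.
have Ax n : A (x n) by case: (pP n).
have chiL n : polar (L n) (chi n) by case: (pP n).
have [Th [Thc Thd ThE]] := null_sequence_extension KG chiL.
have ThL m n y : L m y -> cnorm (Th n y) <= 2 ^+ m * 2^-1 ^+ n.
  by move=> Ly; rewrite ThE; [exact: polar_filtration_decay Ly|exists m].
have Thx n : 4^-1 < cnorm (Th n (x n)) by rewrite ThE; [case: (pP n)|exact: AL].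
pose X e g := csum e (fun n => Th n g).
have Xc e : characters (X e) := csum_character KG e Thc Thd ThL.
pose Psi (P : (nat -> bool) * (nat -> bool)) g := X P.1 g - X P.2 g.
have [c cS] := Sindex.
(* Pairs of index sets whose sums have the same class; their differences lie in [S], where
   clustering is assumed. *)
pose Delta := [set P : (nat -> bool) * (nat -> bool) | c (X P.1) = c (X P.2)].
have DeltaS P : Delta P -> S (Psi P) by move=> DP; apply: cS.
(* The decisive pair is found only after the points have been selected, so a countable dense family
   of pairs is fixed in advance. *)
have [|d [dD dP]] := @pairs_separable Delta; first by exists (xpred0, xpred0).
pose psi i := Psi (d i).
have dense g g' : (forall i, psi i g = psi i g') ->
    forall P, Delta P -> Psi P g = Psi P g'.
  move=> gg' P DP; apply: subr0_eq; apply/cnorm_eq0/eqP.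
  rewrite eq_le cnorm_ge0 andbT; apply/ler_addgt0Pl => e e0; rewrite addr0.
  have [C gC] := Thd g; have [C' gC'] := Thd g'.
  have [M hM] := geometric_lt (8 * C + 8 * C') e0.
  have [i iP] := dP P M DP.
  have near_psi h D : (forall n, cnorm (Th n h) <= D * 2^-1 ^+ n) ->
      cnorm (Psi P h - psi i h) <= 8 * D * 2^-1 ^+ M.
    move=> hD; rewrite /psi /Psi subrACA.
    have h1 := eq_csum_prefix hD (fun m mM => esym (iP m mM).1).
    have h2 := eq_csum_prefix hD (fun m mM => esym (iP m mM).2).
    by apply: le_trans (cnormB _ _) _; move: h1 h2; rewrite -!/(X _ _); lra.
  have h1 := near_psi _ _ gC; have h2 := near_psi _ _ gC'.
  have := cdistD (psi i g) (Psi P g) (Psi P g').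
  by rewrite {2}gg' (cdistC (psi i g')); lra.
have [g gP] := SA Ax (fun i => DeltaS _ (dD i)).
(* These sets generate a filter along which each [psi i (x n)] tends to [psi i g]; an ultrafilter
   above it also supplies limits [lam m] of [Th m (x n)]. *)
pose B k := [set n | (k <= n)%N /\
  forall i, (i < k)%N -> cnorm (psi i (x n) - psi i g) < 2^-1 ^+ k].
have [U [UU UB]] : exists U, UltraFilter U /\ forall k, U (B k).
  have FB : ProperFilter (filter_from setT B).
    apply: filter_from_proper; last first.
      move=> k _; have [|n [kn hn]] := gP k k (2^-1 ^+ k); first by rewrite exprn_gt0.
      by exists n.
    apply: filter_from_filter; first by exists 0%N.
    move=> i j _ _; exists (maxn i j) => // n [mn hn]; split; split.
    - exact: leq_trans (leq_maxl i j) mn.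
    - move=> l li; apply: lt_le_trans (hn l (leq_trans li (leq_maxl i j))) _.
      by rewrite ler_wiXn2l ?leq_maxl//; lra.
    - exact: leq_trans (leq_maxr i j) mn.
    - move=> l li; apply: lt_le_trans (hn l (leq_trans li (leq_maxr i j))) _.
      by rewrite ler_wiXn2l ?leq_maxr//; lra.
  have [U [UU FU]] := ultraFilterLemma FB.
  by exists U; split => // k; apply: FU; exists k.
pose lam m := ulim UU (fun n => Th m (x n)).
have [C CP] : exists C : nat -> R, forall n m, cnorm (Th m (x n)) <= C n * 2^-1 ^+ m.
  by have [C CP] := choice (fun n => Thd (x n)); exists C.
have nextP p0 : exists n, [/\ (p0 < n)%N,
    forall m, (m <= p0)%N -> cnorm (Th m (x n) - lam m) <= 2^-1 ^+ m / 256,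
    forall i, (i <= p0)%N -> cnorm (psi i (x n) - psi i g) < 2^-1 ^+ p0 &
    2 * C p0 * 2^-1 ^+ n <= 64^-1].
  have e64 : 0 < 64^-1 :> R by rewrite invr_gt0.
  have [k kC] := geometric_lt (2 * C p0) e64.
  have C0 : 0 <= C p0 by have := CP p0 0%N; rewrite expr0 mulr1; apply: le_trans; exact: cnorm_ge0.
  have Ulam : \forall n \near U, forall m : 'I_p0.+1,
      cnorm (Th m (x n) - lam m) <= 2^-1 ^+ m / 256.
    apply: filter_forall => m.
    have e : 0 < 2^-1 ^+ m / 256 :> R by rewrite divr_gt0// exprn_gt0.
    by apply: filterS (ulimP UU (fun n => Th m (x n)) e) => n /ltW.
  have [n [hlam [kn hpsi]]] := filter_ex (filterI Ulam (UB (maxn k p0.+1))).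
  exists n; split.
  - exact: leq_trans (leq_maxr k p0.+1) kn.
  - by move=> m mp; exact: (hlam (Ordinal (mp : (m < p0.+1)%N))).
  - move=> i ip; apply: lt_le_trans (hpsi i _) _.
      by apply: leq_trans (leq_maxr k p0.+1).
    rewrite ler_wiXn2l//; first lra.
    by apply: leq_trans (leq_maxr k p0.+1); exact: leqnSn.
  - apply: le_trans (ltW kC); rewrite ler_wpM2l ?mulr_ge0// ler_wiXn2l//; first lra.
    exact: leq_trans (leq_maxl k p0.+1) kn.
have [next {}nextP] := choice nextP.
pose nk k := iter k next 0%N.
have nkS k : (nk k < nk k.+1)%N by case: (nextP (nk k)).
have nk_lt i j : (i < j)%N -> (nk i < nk j)%N.
  elim: j => // j IH; rewrite ltnS leq_eqVlt => /predU1P[->//|/IH h].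
  exact: ltn_trans h (nkS j).
have nk_le i j : (i <= j)%N -> (nk i <= nk j)%N.
  by rewrite leq_eqVlt => /predU1P[->//|/nk_lt/ltnW].
have nk_ge k : (k <= nk k)%N.
  by elim: k => // k IH; exact: leq_trans (nkS k).
have nk_inj i j : nk i = nk j -> i = j.
  move=> ij; case: (ltngtP i j) => // /nk_lt; rewrite ij ltnn //.
have [fold foldP] := infinite_fibers.
(* Only odd positions carry indices; the even position before each serves for comparison. Bit [a l]
   is repeated at every [j] with [fold j = l]. *)
pose E (a : nat -> bool) : nat -> bool := fun m =>
  `[< exists j, m = nk j.*2.+1 /\ a (fold j) >].
have EE a j : E a (nk j.*2.+1) = a (fold j).
  apply/asboolP/idP => [[i [/nk_inj]]|aj]; last by exists j.
  by move=> [/double_inj ->].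
have [a [a' [naa' caa']]] := cantor_collision (fun a => c (X (E a))).
(* From position [2j] to [2j + 1] only the term of index [nk (2j + 1)] matters. The condition
   [0 < j] makes position [2j - 1] available for the bound [p]. *)
have hump b j : (0 < j)%N ->
    cnorm (X (E b) (x (nk j.*2.+1)) - X (E b) (x (nk j.*2)) -
      (if b (fold j) then Th (nk j.*2.+1) (x (nk j.*2.+1)) else 0)) <= 5 / 64.
  move=> j0; rewrite -EE.
  have jE : j.*2 = j.*2.-1.+1 by rewrite prednK ?double_gt0.
  apply: (@gliding_hump R (fun m n => Th m (x n)) C lam (E b) (nk j.*2.-1) _ _
    (nk j.*2.+2)) => //.
  - by rewrite !nkS.
  - by move=> m mp; rewrite jE; case: (nextP (nk j.*2.-1)) => _ + _ _; exact.
  - move=> m mp; case: (nextP (nk j.*2)) => _ + _ _; apply.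
    by apply: leq_trans mp _; apply: nk_le; exact: leq_pred.
  - by case: (nextP (nk j.*2)).
  - by case: (nextP (nk j.*2.+1)).
  move=> m /asboolP[i [-> _]]; case: (ltngtP i j) => [ij|ij|->].
  - by apply: Or31; apply: nk_le; lia.
  - by apply: Or33; apply: nk_le; lia.
  - exact: Or32.
pose P := (E a, E a'); have DP : Delta P by [].
have [l al] : exists l, a l != a' l.
  apply: contrapT => h; apply: naa'; apply/funext => l.
  by apply/eqP; apply: contrapT => /negP nl; apply: h; exists l.
(* Where bit [l] differs, [Psi P] changes by at least 1/4 - 10/64 = 6/64, so one of the two points
   is 3/64 away from [Psi P g]. *)
have far N : exists k, (N <= k)%N /\ 3 / 64 <= cnorm (Psi P (x (nk k.+1)) - Psi P g).
  have [j [Nj jl]] := foldP l N.+1.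
  have j0 : (0 < j)%N by exact: leq_ltn_trans Nj.
  set y := x (nk j.*2.+1); set z := x (nk j.*2).
  have yz : 6 / 64 <= cnorm (Psi P y - Psi P z).
    have := hump a j j0; have := hump a' j j0; rewrite jl -/y -/z /Psi /= subrACA.
    set D := X (E a) y - _; set D' := X (E a') y - _; set w := Th _ _.
    have w4 : 4^-1 < cnorm w by exact: Thx.
    have Dw := cdistD D w 0; have DD' := cdistD D' D 0.
    have D'w := cdistD D' w 0; have D'D := cdistD D D' 0.
    rewrite !subr0 in Dw DD' D'w D'D; rewrite (cdistC w) in Dw; rewrite (cdistC w) in D'w.
    rewrite (cdistC D') in D'D.
    by case: (a l) (a' l) al => [] [] // _; rewrite subr0 => h' h; lra.
  have := cdistD (Psi P g) (Psi P y) (Psi P z); rewrite (cdistC (Psi P g)) => tri.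
  have [yg|yg] := leP (3 / 64) (cnorm (Psi P y - Psi P g)).
    by exists j.*2; split => //; lia.
  exists j.*2.-1; split; first by lia.
  by rewrite prednK ?double_gt0// -/z; lra.
have [kk kkP] := choice far.
pose psi' i := if i is i'.+1 then psi i' else Psi P.
have [g' g'P] : exists g', forall M N (e : R), 0 < e -> exists n, (N <= n)%N /\ forall i,
    (i < M)%N -> cnorm (psi' i (x (nk (kk n).+1)) - psi' i g') < e.
  by apply: SA => [n|[|i]]; [exact: Ax|exact: DeltaS|exact/DeltaS/dD].
(* The selected points have [psi i] values converging to [psi i g], so the new cluster point agrees
   with [g] there, and by density also under [Psi P]. *)
have gg' i : psi i g' = psi i g.
  apply: subr0_eq; apply/cnorm_eq0/eqP.
  rewrite eq_le cnorm_ge0 andbT; apply/ler_addgt0Pl => e e0; rewrite addr0.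
  have e2 : 0 < e / 2 by lra.
  have [k hk] := geometric_lt 1 e2.
  have [n [nN /(_ i.+1 (ltnSn _)) /= hn]] := g'P i.+2 (maxn i k) _ e2.
  have nkn : (n <= nk (kk n))%N by exact: leq_trans (kkP n).1 (nk_ge _).
  have [_ _ /(_ i) h _] := nextP (nk (kk n)).
  have {}h : cnorm (psi i (x (nk (kk n).+1)) - psi i g) < e / 2.
    apply: lt_trans (h _) _; first by apply: leq_trans nkn; exact: leq_trans (leq_maxl _ _) nN.
    apply: le_lt_trans hk; rewrite mul1r ler_wiXn2l//; first lra.
    by apply: leq_trans nkn; exact: leq_trans (leq_maxr _ _) nN.
  have := cdistD (psi i (x (nk (kk n).+1))) (psi i g') (psi i g).
  by rewrite (cdistC (psi i g') (psi i (x (nk (kk n).+1)))); lra.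
have PE := dense _ _ gg' P DP.
have e3 : 0 < 3 / 64 :> R by lra.
have [n [_ /(_ 0%N isT) /=]] := g'P 1%N 0%N _ e3.
by have := (kkP n).2; rewrite PE; lra.
Qed.
End CoreHull.

(** Greedy choice: elements unrelated to all earlier ones are picked until the list covers [A], or
    forever. The default of [nth] is quantified since [T] may be empty. *)
Lemma finite_cover_or_sequence (T : Type) (A : set T) (r : T -> T -> Prop) :
  (exists s : seq T, forall a, A a ->
    exists2 i, (i < size s)%N & forall d, A (nth d s i) /\ r (nth d s i) a) \/
  exists b : nat -> T, (forall n, A (b n)) /\ forall i n, (i < n)%N -> ~ r (b i) (b n).
Proof.
have [[s sA]|ns] := pselect (exists s : seq T,
    forall a, A a ->
    exists2 i, (i < size s)%N & forall d, A (nth d s i) /\ r (nth d s i) a).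
  by left; exists s.
right.
have pickP (s : seq T) : exists a, A a /\
    forall i d, (i < size s)%N -> A (nth d s i) -> ~ r (nth d s i) a.
  apply: contrapT => h; apply: ns; exists s => a Aa; apply: contrapT => na.
  apply: h; exists a; split=> // i d si Ai ri; apply: na; exists i => // d'.
  by rewrite (set_nth_default d).
have [pick {}pickP] := choice pickP.
pose s := fix s n := if n is m.+1 then rcons (s m) (pick (s m)) else [::].
have sizes n : size (s n) = n by elim: n => //= n IH; rewrite size_rcons IH.
have nths n i d : (i < n)%N -> nth d (s n) i = pick (s i).
  elim: n => // n IH; rewrite ltnS leq_eqVlt => /predU1P[->|lt] /=.
    by rewrite nth_rcons sizes ltnn eqxx.
  by rewrite nth_rcons sizes lt; exact: IH.
exists (fun n => pick (s n)); split=> [n|i n lt]; first by case: (pickP (s n)).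
have [_ /(_ i (pick (s i)))] := pickP (s n).
by rewrite sizes nths// => /(_ lt); apply; case: (pickP (s i)).
Qed.

Lemma compact_sequence_close (G : topologicalZmodType) (C O : set G) (b : nat -> G) :
  compact C -> nbhs (0 : G) O -> (forall n, C (b n)) ->
  exists i n, (i < n)%N /\ O (b n - b i).
Proof.
move=> cC O0 bC.
have [W W0 WO] := nbhs_sub_split O0.
have Cb : (b @ \oo) C by exists 0%N => // n _; exact: bC.
have [y [_ ycl]] := cC (b @ \oo) _ Cb.
have tail N : (b @ \oo) [set b n | n in [set n | (N <= n)%N]].
  by exists N => // n Nn; exists n.
have [_ [[i _ <-] Wi]] := ycl _ _ (tail 0%N) (nbhs_addl y W0).
have [_ [[n /= lt <-] Wn]] := ycl _ _ (tail i.+1) (nbhs_addl y W0).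
exists i, n; split=> //.
by have := WO _ _ Wn Wi; rewrite subrACA subrr subr0.
Qed.

Lemma compact_finite_cover (G : topologicalZmodType) (C O : set G) :
  compact C -> nbhs (0 : G) O -> exists s : seq G, forall a, C a ->
    exists2 i, (i < size s)%N & C (nth 0 s i) /\ O (a - nth 0 s i).
Proof.
move=> cC O0.
have [[s sC]|[b [bC bO]]] := finite_cover_or_sequence C (fun y a => O (a - y)).
  by exists s => a /sC[i si h]; exists i.
by have [i [n [lt /bO]]] := compact_sequence_close cC O0 bC; move=> /(_ lt).
Qed.

(** * Containment in a compact set *)

Section Core.
Variables (R : realType) (G : topologicalZmodType).
Hypothesis kG : locally_k_omega G.
Hypothesis lqG : locally_quasiconvex R G.
Variables (S : set (G -> circle R)) (A : set G).
Hypothesis SA : countably_clusters S A.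
Hypothesis Sindex : countable_index S.

(** Both bounds combine for sets inside one span; the freedom in [f] then controls the number of
    cosets of H. *)
Theorem countably_clusters_compact : exists2 C, compact C & A `<=` C.
Proof.
have [U [K [oU U0 cK _ [KU Ktop]]]] := locally_k_omegaP 0 kG.
have KG : k_omega_nbhs0 K.
  by split=> //; rewrite KU; exact: open_nbhs_nbhs.
have bounded f B : B `<=` A -> B `<=` span K f -> exists n, B `<=` filtration K f n.
  move=> BA BL.
  have SB : countably_clusters S B by move=> x psi Bx; apply: SA => n; exact: BA.
  have [n Bn] := sub_hull_filtration KG BL SB Sindex.
  by apply: (hull_sub_filtration kG.1 lqG KG BL _ Bn); exact: filtration_compact.
pose H := span K (fun=> 0).
have [[s sA]|[b [bA bH]]] := finite_cover_or_sequence A (fun y a => H (a - y)).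
  (* Finitely many cosets: their representatives, padded with zeros by [nth], are adjoined. *)
  have [|n An] := bounded (nth 0 s) A (@subset_refl _ _).
    move=> a /sA[i si /(_ 0)[_ Hi]]; rewrite -(subrK (nth 0 s i) a).
    apply: spanD; last exact: span_mem.
    by have [n _ Ln] := Hi; exists n => //; exact: filtration_mono.
  by exists (filtration K (nth 0 s) n) => //; exact: filtration_compact.
(* Infinitely many cosets: adjoining [b] itself puts its range into a compact set, so two of its
   terms differ by an element of the neighbourhood H of 0. *)
have [|_ [n _ <-]|n bn] := bounded b (range b).
- by move=> _ [n _ <-].
- exact: span_mem.
have H0 : nbhs (0 : G) H.
  by have [_ + _] := KG; apply: filterS => x; exact: sub_span.
have cL : compact (filtration K b n) by exact: filtration_compact.
have [i [m [lt Hm]]] := compact_sequence_close cL H0 (fun m => bn _ (ex_intro2 _ _ m I erefl)).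
by case: (bH i m lt).
Qed.

End Core.

Lemma compact_cluster (R : realType) (Y : topologicalType) (C : set Y)
    (psi : nat -> Y -> circle R) (y : nat -> Y) :
  compact C -> (forall i, continuous (psi i)) -> (forall n, C (y n)) ->
  exists2 g, C g & forall M N (e : R), 0 < e ->
    exists n, (N <= n)%N /\ forall i, (i < M)%N -> cnorm (psi i (y n) - psi i g) < e.
Proof.
move=> cC cpsi Cy.
have [g [Cg gcl]] := cC (y @ \oo) _ (filterS (fun n _ => Cy n) filterT).
exists g => // M N e e0.
have near_g : \forall z \near g, forall i : 'I_M, cnorm (psi i z - psi i g) < e.
  by apply: filter_forall => i; exact: ((cts_circleP _ _).1 (cpsi i g)).
have [|_ [[n Nn <-] h]] := gcl [set y n | n in [set n | (N <= n)%N]] _ _ near_g.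
  by exists N => // n Nn; exists n.
by exists n; split=> // i iM; exact: (h (Ordinal iM)).
Qed.

(** * Clustering from functional boundedness *)

Section FunctionallyBounded.
Variables (R : realType) (X : topologicalType) (A : set X).
Variables (psi : nat -> X -> circle R) (x : nat -> X).
Hypothesis bA : functionally_bounded R A.
Hypothesis cpsi : forall i, continuous (psi i).
Hypothesis Ax : forall n, A (x n).

Let d y z := sup [set 2^-1 ^+ i * cnorm (psi i y - psi i z) | i in [set: nat]].

Let d_has_sup y z : has_sup [set 2^-1 ^+ i * cnorm (psi i y - psi i z) | i in [set: nat]].
Proof.
split; first by exists (2^-1 ^+ 0 * cnorm (psi 0%N y - psi 0%N z)); exists 0%N.
exists 1 => _ [i _ <-].
have := cnorm_le_half (psi i y - psi i z); have := cnorm_ge0 (psi i y - psi i z).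
have h : 2^-1 ^+ i <= 1 :> R by rewrite exprn_ile1//; lra.
move=> h1 h2; apply: le_trans h; rewrite ler_piMr ?exprn_ge0//; lra.
Qed.

Let d_ge y z i : 2^-1 ^+ i * cnorm (psi i y - psi i z) <= d y z.
Proof. by apply: sup_upper_bound => //; exists i. Qed.

Let d_le y z (e : R) : (forall i, 2^-1 ^+ i * cnorm (psi i y - psi i z) <= e) -> d y z <= e.
Proof. by move=> h; apply: ge_sup; [case: (d_has_sup y z)|move=> _ [i _ <-]]. Qed.

Let d_ge0 y z : 0 <= d y z.
Proof. by apply: le_trans (d_ge y z 0); rewrite mulr_ge0 ?exprn_ge0 ?cnorm_ge0. Qed.

Let d_triangle w y z : d y z <= d y w + d w z.
Proof.
apply: d_le => i; apply: le_trans (lerD (d_ge y w i) (d_ge w z i)).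
by rewrite -mulrDr ler_wpM2l ?exprn_ge0//; exact: cdistD.
Qed.

Let d_near y (e : R) : 0 < e -> \forall z \near y, d y z <= e.
Proof.
move=> e0; have [k hk] := geometric_lt 1 e0.
have h : \forall z \near y, forall i : 'I_k, cnorm (psi i z - psi i y) < e.
  by apply: filter_forall => i; exact: ((cts_circleP _ _).1 (@cpsi i y)).
apply: filterS h => z h; apply: d_le => i.
have g0 : 0 <= 2^-1 ^+ i :> R by rewrite exprn_ge0.
have [ik|ki] := ltnP i k.
  rewrite cdistC; apply: le_trans (ltW (h (Ordinal ik))).
  by rewrite ler_piMl ?cnorm_ge0// exprn_ile1//; lra.
apply: le_trans (ltW hk); rewrite mul1r.
apply: (@le_trans _ _ (2^-1 ^+ i)).
  by rewrite ler_piMr//; have := cnorm_le_half (psi i y - psi i z); lra.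
by rewrite ler_wiXn2l//; lra.
Qed.

(** A perturbed distance to the sequence: the summand [1 / (n + 1)] lets [h] vanish only at points
    approached by terms of arbitrarily large index, while [h (x n)] tends to 0. *)
Let h y := inf [set d y (x n) + n.+1%:R^-1 | n in [set: nat]].

Let h_has_inf y : has_inf [set d y (x n) + n.+1%:R^-1 | n in [set: nat]].
Proof.
split; first by exists (d y (x 0%N) + 1%:R^-1); exists 0%N.
by exists 0 => _ [n _ <-]; rewrite addr_ge0 ?d_ge0// invr_ge0.
Qed.

Let h_le y n : h y <= d y (x n) + n.+1%:R^-1.
Proof. by apply: ge_inf; [case: (h_has_inf y)|exists n]. Qed.

Let h_ge y (e : R) : (forall n, e <= d y (x n) + n.+1%:R^-1) -> e <= h y.
Proof. by move=> he; apply: lb_le_inf; [case: (h_has_inf y)|move=> _ [n _ <-]]. Qed.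

Let h_lipschitz y z : h z <= h y + d z y.
Proof.
rewrite -lerBlDr; apply: h_ge => n; rewrite lerBlDr.
apply: le_trans (h_le z n) _; rewrite addrAC lerD2r addrC.
exact: d_triangle.
Qed.

Let d_sym y z : d y z = d z y.
Proof.
suff le_d u v : d u v <= d v u by apply/eqP; rewrite eq_le !le_d.
by apply: d_le => i; rewrite cdistC; exact: d_ge.
Qed.

Let h_continuous : continuous h.
Proof.
move=> y; apply/cvgrPdist_le => e e0; apply: filterS (d_near y e0) => z yz.
rewrite ler_distl; apply/andP; split.
  by have := h_lipschitz y z; rewrite d_sym; lra.
by have := h_lipschitz z y; lra.
Qed.

(* Otherwise [1 / h] is continuous, but unbounded along [x]. *)
Lemma functionally_bounded_cluster : exists g, forall M N (e : R), 0 < e ->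
  exists n, (N <= n)%N /\ forall i, (i < M)%N -> cnorm (psi i (x n) - psi i g) < e.
Proof.
apply: contrapT => nocl.
have h_gt0 y : 0 < h y.
  apply: contrapT => /negP; rewrite -leNgt => hy; apply: nocl; exists y => M N e e0.
  apply: contrapT => nfar.
  have far n : (N <= n)%N -> 2^-1 ^+ M * e <= d y (x n).
    move=> Nn; apply: contrapT => /negP; rewrite -ltNge => dn.
    apply: nfar; exists n; split=> // i iM; rewrite cdistC.
    rewrite -(@ltr_pM2l _ (2^-1 ^+ M)) ?exprn_gt0//; apply: le_lt_trans dn.
    apply: le_trans (d_ge _ _ i); rewrite ler_wpM2r ?cnorm_ge0//.
    by rewrite ler_wiXn2l//; [lra|exact: ltnW].
  (* Terms of index at least [N] are bounded below by the distance, earlier ones by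
     [1 / (N + 1)]. *)
  have : Num.min (2^-1 ^+ M * e) N.+1%:R^-1 <= h y.
    apply: h_ge => n; rewrite ge_min; have [Nn|nN] := leqP N n.
      by apply/orP; left; apply: le_trans (far n Nn) _; rewrite lerDl invr_ge0.
    apply/orP; right; apply: (@le_trans _ _ n.+1%:R^-1); last by rewrite lerDr.
    by rewrite lef_pV2 ?posrE// ler_nat ltnS ltnW.
  by rewrite leNgt (le_lt_trans hy)// lt_min invr_gt0 ltr0n mulr_gt0// exprn_gt0.
have cf : continuous (fun y => (h y)^-1).
  by move=> y; apply: cvgV; [rewrite gt_eqF|exact: h_continuous].
have [M [Mr hM]] := bA cf.
have [n Mn] : exists n : nat, M + 1 < n%:R.
  by exists (Num.truncn (M + 1)).+1; exact: truncnS_gt.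
have M1 : M < M + 1 by rewrite ltrDl.
have /= := hM _ M1 _ (ex_intro2 _ _ (x n) (Ax n) erefl).
have h0 : 0 <= (h (x n))^-1 by rewrite invr_ge0; exact: ltW.
rewrite (ger0_norm h0).
rewrite leNgt => /negP; apply.
have : h (x n) <= n.+1%:R^-1.
  apply: le_trans (h_le _ n) _; rewrite gerDr.
  by apply: d_le => i; rewrite subrr cnorm0 mulr0.
move=> hn; apply: lt_le_trans Mn _.
apply: (@le_trans _ _ n.+1%:R); first by rewrite ler_nat.
by rewrite -[leLHS]invrK lef_pV2 ?posrE// invr_gt0.
Qed.

End FunctionallyBounded.

Lemma compact_setT_set_type (X : topologicalType) (C : set X) :
  compact C -> compact [set: set_type C].
Proof.
move=> cC F FF _.
have FC : F (set_val @^-1` C) by apply: filterS filterT => x _; exact: set_valP.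
have [y [Cy ycl]] := cC (set_val @ F) _ FC.
exists (SigSub (mem_set Cy)); split=> // P Q FP [W [[V oV <-] Vy] VQ].
have FP' : F (set_val @^-1` (set_val @` P)) by apply: filterS FP => x Px; exists x.
have [_ [[x Px <-] Vx]] := ycl _ _ FP' (open_nbhs_nbhs (conj oV Vy)).
by exists x; split=> //; exact: VQ.
Qed.

(** * The Bohr compactification *)

Section Bohr.
Variables (R : realType) (G bG : topologicalZmodType) (b : G -> bG).
Hypothesis bohr : bohr_compactification b.

Lemma bohr_character (chi : G -> circle R) : characters chi ->
  exists chib : bG -> circle R, characters chib /\ forall x, chi x = chib (b x).
Proof.
move=> [cchi chiD]; have [_ _ _ _ univ] := bohr.
have [hb [chb hbD hbE]] :=
  univ (mcircle R) chi (@circle_compact R) (@circle_hausdorff R) cchi chiD.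
by exists hb.
Qed.

Lemma bohr_injective : hausdorff_space G -> locally_quasiconvex R G -> injective b.
Proof.
move=> hG lqG x y bxy; apply/eqP; rewrite -subr_eq0; apply/negPn/negP => xy.
have [chi chiC /eqP] := locally_quasiconvex_separates hG lqG xy; apply.
have [chib [[_ chibD] ->]] := bohr_character chiC.
have [_ _ bD _ _] := bohr.
by rewrite (morph_sub bD) bxy subrr (morph0 chibD).
Qed.

(** Separating functions on the compact Hausdorff [bG] pull back along [b]. This admits the Bohr
    topology as a target in [compact_intrinsic]. *)
Lemma bohr_tychonoff : injective b -> Defs.tychonoff (initial_topology b).
Proof.
move=> binj; have [[cbG hbG] _ _ _ _] := bohr.
have cb : continuous (b : initial_topology b -> bG) by exact: initial_continuous.
split.
  have crbG : completely_regular_space bG.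
    exact: (@normal_completely_regular R _ (compact_normal hbG cbG)
      (hausdorff_accessible hbG)).
  move=> x B cB nBx.
  have [D [cD DB]] : exists D : set bG, closed D /\ B = b @^-1` D.
    have [V oV VB] : open (~` B) by rewrite openC.
    exists (~` V); split; first by rewrite closedC.
    by rewrite -[B]setCK -VB.
  have nDx : ~ D (b x) by move: nBx; rewrite DB.
  have [g [cg g01 gx gD]] := (uniform_separatorP (R := R) _ _).1 (crbG _ _ cD nDx).
  apply/(uniform_separatorP (R := R)); exists (g \o b); split.
  - move=> y; apply: (@continuous_comp (initial_topology b) bG R b g y); [exact: cb|exact: cg].
  - by move=> _ [y _ <-]; apply: g01; exists (b y).
  - by move=> _ [y -> <-]; apply: gx; exists (b x).
  - by move=> _ [y + <-]; rewrite DB => Dy; apply: gD; exists (b y).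
move=> x y xy; apply: binj; apply: hbG => U V Ux Vy.
have [z [Uz Vz]] := xy _ _ (cb x _ Ux) (cb y _ Vy).
by exists (b z).
Qed.

(** Either form of the property gives functional boundedness in the Bohr topology, hence containment
    in a compact [C] of [G]. [C] embeds in both spaces, so [compact_intrinsic] transfers the
    property through it. *)
Lemma bohr_respects :
  completely_regular_space G -> locally_k_omega G -> locally_quasiconvex R G ->
  forall P : subset_property, compact_intrinsic P ->
    stronger_than_functional_boundedness R P G ->
    stronger_than_functional_boundedness R P (initial_topology b) ->
    respects b P.
Proof.
move=> crG kG lqG P Pint PG PG' A.
have [[_ _] cb bD _ _] := bohr.
have binj := bohr_injective kG.1 lqG.
have tX := bohr_tychonoff binj.
have key : functionally_bounded R (A : set (initial_topology b)) ->
    P G A <-> P (initial_topology b) A.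
  move=> fbA.
  have clA : countably_clusters (@characters R G) A.
    move=> x psi Ax psiC.
    apply: (@functionally_bounded_cluster R (initial_topology b) A psi x fbA _ Ax) => i.
    have [chib [[cchib _] chibE]] := bohr_character (psiC i).
    rewrite (_ : psi i = chib \o b); last by apply/funext.
    move=> y; apply: (@continuous_comp (initial_topology b) bG _ b chib y).
      exact: initial_continuous.
    exact: cchib.
  have Sidx : countable_index (@characters R G).
    by exists (fun=> 0%N) => chi psi chiC psiC _; exact: characterB.
  have [C cC AC] := countably_clusters_compact kG lqG clA Sidx.
  pose e : set_type C -> G := set_val.
  have eA : e @` (e @^-1` A) = A.
    apply/seteqP; split=> [_ [x Ax <-]//|x Ax].
    by exists (SigSub (mem_set (AC _ Ax))).
  have cK := compact_setT_set_type cC.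
  have ce : continuous e by exact: initial_continuous.
  have ce' : continuous (e : set_type C -> initial_topology b).
    apply: (@continuous_comp_initial _ _ _ b e) => x.
    by apply: continuous_comp; [exact: ce|exact: cb].
  have ie : injective e by exact: val_inj.
  rewrite -eA; apply: (@iff_trans _ (P (set_type C) (e @^-1` A))).
    by apply: iff_sym; apply: Pint => //; split => //; exact: kG.1.
  exact: Pint.
split=> PA; apply/key => //; last exact: PG' PA.
move=> g cg; apply: (PG _ PA) => x.
apply: (@continuous_comp G (initial_topology b) R id g); last exact: cg.
exact: (continuous_comp_initial cb).
Qed.

End Bohr.

(** * Metrizable subgroups and quotients *)

Section ClosedSubgroup.
Variables (R : realType) (A : topologicalZmodType) (N : zmodClosed A).
Local Notation NS := [set x : A | x \in N].
Local Notation Y := (quotient_topology (Quotient.quot N)).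
Local Notation proj := (fun x : A => \pi_Y%qT x).

Lemma zmodClosed_mulrn x k : x \in N -> x *+ k \in N.
Proof.
move=> Nx; elim: k => [|k IH]; first by rewrite mulr0n rpred0.
by rewrite mulrSr -[X in _ + X]opprK rpredB// -sub0r rpredB ?rpred0.
Qed.

(** The base is given by traces of neighbourhoods in [A], so that [N] can be covered by translates
    inside [A]. *)
Lemma metrizable_countable_base : metrizable R (set_type NS) ->
  exists W : nat -> set A, (forall i, nbhs (0 : A) (W i)) /\
    forall V, nbhs (0 : A) V -> exists i, forall x, x \in N -> W i x -> V x.
Proof.
move=> [M [h [k [ch ck hK kK]]]].
have N0 : NS 0 by exact: rpred0.
pose z : set_type NS := SigSub (mem_set N0).
have WP i : exists W, nbhs (0 : A) W /\
      forall y : set_type NS, W (set_val y) -> ball (h z) i.+1%:R^-1 (h y).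
  have : nbhs z (h @^-1` ball (h z) i.+1%:R^-1).
    by apply: ch; apply: nbhsx_ballx; rewrite invr_gt0.
  move=> [_ [[W oW <-] Wz] sub]; exists W; split; first exact: open_nbhs_nbhs.
  by move=> y Wy; exact: sub.
have [W {}WP] := choice WP.
exists W; split=> [i|V V0]; first by case: (WP i).
have : nbhs (h z) ((set_val \o k) @^-1` V).
  apply: (@continuous_comp _ _ _ k set_val (h z)); [exact: ck|exact: initial_continuous|].
  by rewrite /= hK.
move=> /nbhs_ballP[e /= e0 eV].
have [i ie] : exists i : nat, i.+1%:R^-1 < e.
  exists (Num.truncn e^-1); rewrite invf_plt ?posrE//; exact: truncnS_gt.
exists i => x Nx Wx.
have [_ /(_ (SigSub (mem_set (Nx : NS x))) Wx) hb] := WP i.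
have := eV _ (le_ball (ltW ie) hb).
by rewrite /= hK.
Qed.

(* A character that is at most [1/4] on a group is trivial on it; on the compact
   group [N] this can be read off from finitely many rounded values. *)
Lemma metrizable_countable_characters : compact NS -> metrizable R (set_type NS) ->
  exists c : (A -> circle R) -> nat, forall chi psi,
    characters chi -> characters psi -> c chi = c psi ->
    forall x, x \in N -> chi x = psi x.
Proof.
move=> cN mN; have [W [W0 WP]] := metrizable_countable_base mN.
have [F FP] := choice (fun i => compact_finite_cover cN (W0 i)).
have iP (chi : A -> circle R) : exists i, characters chi ->
    forall x, x \in N -> W i x -> cnorm (chi x) < 16^-1.
  have [chiC|] := pselect (characters chi); last by exists 0%N.
  have e16 : 0 < 16^-1 :> R by rewrite invr_gt0.
  have := (cts_circleP _ _).1 (chiC.1 0) _ e16.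
  rewrite (morph0 chiC.2) => /WP[i iP].
  by exists i => _ x Nx /(iP x Nx); rewrite subr0.
have [idx {}iP] := choice iP.
(* Rounding to cells of length 1/16; the shift by 1/2 makes the representative nonnegative. *)
pose rnd (t : circle R) := Num.truncn ((circle_rep t + 2^-1) * 16).
have rndP s t : rnd s = rnd t -> cnorm (s - t) < 16^-1.
  have rnd_itv u : (rnd u)%:R <= (circle_rep u + 2^-1) * 16 < (rnd u).+1%:R.
    apply: truncn_itv; have /andP[+ _] := circle_rep_range u; lra.
  move=> st; have /andP[s1 s2] := rnd_itv s; have /andP[t1 t2] := rnd_itv t.
  rewrite -(circle_repK s) -(circle_repK t) -cpiN -cpiD.
  apply: le_lt_trans (cnorm_cpi_le _) _.
  rewrite st in s1 s2; move: s1 s2 t1 t2; rewrite -(natr1 (rnd t)) => s1 s2 t1 t2.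
  by rewrite ltr_norml; apply/andP; split; lra.
exists (fun chi => pickle (idx chi, [seq rnd (chi y) | y <- F (idx chi)])).
move=> chi psi chiC psiC /(pcan_inj pickleK)[idxE rndE] x Nx.
have thC := characterB chiC psiC.
(* It suffices to bound [chi - psi] by 1/4 on all of [N]; three errors below 1/16 add up to less. *)
apply: subr0_eq; apply: cnorm_subgroup => k.
rewrite -(morph_mulrn k thC.2).
move: (x *+ k) (zmodClosed_mulrn k Nx) => {Nx}x Nx.
have [j js [Nj Wj]] := FP (idx chi) x Nx.
set y := nth 0 _ j in Nj Wj.
have Nxy : x - y \in N by rewrite rpredB.
have h1 := iP chi chiC _ Nxy Wj.
have h2 := iP psi psiC _ Nxy; rewrite -idxE in h2; have {}h2 := h2 Wj.
have h3 : cnorm (chi y - psi y) < 16^-1.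
  apply: rndP; move: rndE => /(congr1 (fun s => nth 0%N s j)).
  by rewrite !(nth_map 0) -?idxE.
have -> : chi x - psi x = (chi (x - y) - psi (x - y)) + (chi y - psi y).
  by rewrite (morph_sub chiC.2) (morph_sub psiC.2) subrACA subrK.
have := cnormD (chi (x - y) - psi (x - y)) (chi y - psi y).
by have := cnormB (chi (x - y)) (psi (x - y)); lra.
Qed.

Lemma quot_projP x y : proj x = proj y <-> x - y \in N.
Proof.
rewrite Quotient.idealrBE; exact: (rwP (@eqP (Quotient.quot N) _ _)).
Qed.

Lemma quot_proj_open U x : nbhs x U -> nbhs (proj x) (proj @` U).
Proof.
rewrite nbhsE => -[V [oV Vx] VU].
apply: (@filterS _ _ _ (proj @` V)); first exact: image_subset.
apply: open_nbhs_nbhs; split; last by exists x.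
rewrite /open/= /quotient_open.
rewrite openE => y [v Vv /quot_projP vy].
have : nbhs y (fun z => V (z - (y - v))).
  by apply: cts_subr; rewrite opprB addrC subrK; exact: open_nbhs_nbhs.
apply: filterS => z Vz; exists (z - (y - v)) => //.
by apply/quot_projP; rewrite addrAC subrr sub0r opprB.
Qed.

Lemma quot_hausdorff : closed NS -> hausdorff_space Y.
Proof.
move=> cN p q.
rewrite -(reprK p) -(reprK q); set x := repr p; set y := repr q => xy.
apply/quot_projP; apply: cN => V.
move=> /(@sub_continuous A (x, y))[[V1 V2] [/= h1 h2] h].
have [_ [[u V1u <-] [v V2v /esym/quot_projP uv]]] :=
  xy _ _ (quot_proj_open h1) (quot_proj_open h2).
by exists (u - v); split=> //; exact: (h (u, v)).
Qed.

Lemma quot_character (chi : A -> circle R) : characters chi ->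
  (forall x, x \in N -> chi x = 0) ->
  exists2 chi' : Y -> circle R, continuous chi' & forall x, chi x = chi' (proj x).
Proof.
move=> [cchi chiD] chiN; exists (fun y => chi (repr y)).
  apply: repr_comp_continuous => // x y /eqP/quot_projP /chiN.
  by rewrite (morph_sub chiD) => /subr0_eq ->.
move=> x; apply: subr0_eq; rewrite -(morph_sub chiD); apply: chiN.
by apply/quot_projP; rewrite reprK.
Qed.

End ClosedSubgroup.

(** * Strong respect for compactness *)

Section StronglyRespects.
Variables (R : realType) (G bG : topologicalZmodType) (b : G -> bG).
Hypothesis bohr : bohr_compactification b.

(** [A] and its saturation [B] have the same image in [bG / N]. If that image is compact, [B] is
    closed as its preimage and need only be shown to lie in a compact set. *)
Lemma bohr_strongly_respects_compactness :
  locally_k_omega G -> locally_quasiconvex R G ->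
  strongly_respects_compactness R b.
Proof.
move=> kG lqG N cN mN A.
have [[cbG hbG] cb bD _ _] := bohr.
pose Y := quotient_topology (Quotient.quot N).
pose proj (x : bG) : Y := \pi_Y%qT x.
have cproj : continuous (proj \o b).
  by move=> x; apply: continuous_comp; [exact: cb|exact: (@pi_continuous _ (Quotient.quot N))].
set B := [set a + n | a in A & n in _].
have imB : (proj \o b) @` B = (proj \o b) @` A.
  apply/seteqP; split=> [_ [_ [a Aa [n Nn <-]] <-]|_ [a Aa <-]].
    exists a => //; apply/quot_projP; rewrite bD opprD addrA subrr sub0r.
    by rewrite -sub0r rpredB ?rpred0.
  exists (a + 0); last by rewrite addr0.
  by exists a => //; exists 0 => //=; rewrite (morph0 bD) rpred0.
split=> [cB|cA].
  rewrite -[X in compact X]imB.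
  by apply: continuous_compact => //; exact: continuous_subspaceT.
have BE : B = (proj \o b) @^-1` ((proj \o b) @` A).
  apply/seteqP; split=> [x Bx|x [a Aa /esym/quot_projP ax]].
    by rewrite -imB; exists x.
  exists a => //; exists (x - a); last by rewrite addrC subrK.
  by rewrite /= (morph_sub bD).
have clB : closed B.
  rewrite BE; apply: closed_comp; first by move=> x _; exact: cproj.
  by apply: compact_closed => //; exact: quot_hausdorff.
have cNS : compact [set x : bG | x \in N] by exact: subclosed_compact cbG _.
(* Characters with an extension trivial on [N] factor through [bG / N], where the image of [A] is
   compact. *)
pose S := [set chi : G -> circle R | exists chib : bG -> circle R,
  [/\ characters chib, forall x, chi x = chib (b x) & forall x, x \in N -> chib x = 0]].
have SB : countably_clusters S B.
  move=> x psi Bx Spsi.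
  have psi'P i : exists psi' : Y -> circle R, continuous psi' /\
      forall x, psi i x = psi' (proj (b x)).
    have [chib [chibC chibE chibN]] := Spsi i.
    have [psi' cpsi' psi'E] := quot_character chibC chibN.
    by exists psi'; split => // y; rewrite chibE psi'E.
  have [psi' {}psi'P] := choice psi'P.
  have [|n|_ [a Aa <-] aP] := @compact_cluster R Y _ psi' (fun n => proj (b (x n))) cA.
  - by move=> i; case: (psi'P i).
  - by have := Bx n; rewrite BE.
  exists a => M n e e0; have [k [nk kP]] := aP M n e e0.
  exists k; split=> // i iM; rewrite !(psi'P i).2; exact: kP.
(* Characters are classified by restricting an extension to the compact metrizable [N], which has
   only countably many characters. *)
have Sindex : countable_index S.
  have [c cP] := metrizable_countable_characters cNS mN.
  have extP (chi : G -> circle R) : exists chib : bG -> circle R, characters chi ->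
      characters chib /\ forall x, chi x = chib (b x).
    have [chiC|] := pselect (characters chi); last by exists (fun=> 0).
    by have [chib h] := bohr_character bohr chiC; exists chib.
  have [ext {}extP] := choice extP.
  exists (fun chi => c (ext chi)) => chi psi chiC psiC cE.
  have [eC eE] := extP chi chiC; have [eC' eE'] := extP psi psiC.
  exists (fun x => ext chi x - ext psi x); split; first exact: characterB.
    by move=> x; rewrite eE eE'.
  by move=> x Nx; rewrite (cP _ _ eC eC' cE x Nx) subrr.
have [C cC BC] := countably_clusters_compact kG lqG SB Sindex.
exact: subclosed_compact clB cC BC.
Qed.

End StronglyRespects.

Theorem theorem5 (R : realType) (G bG : topologicalZmodType) (b : G -> bG)
    (Ginfinite : infinite_set [set: G])
    (Gregular : completely_regular_space G)
    (Gkomega : locally_k_omega G)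
    (Gconvex : locally_quasiconvex R G)
    (bohr : bohr_compactification b) :
  (forall P : subset_property,
     compact_intrinsic P ->
     stronger_than_functional_boundedness R P G ->
     stronger_than_functional_boundedness R P (initial_topology b) ->
     respects b P) /\
  strongly_respects_compactness R b.
Proof.
split; last exact: bohr_strongly_respects_compactness.
by move=> P; exact: (@bohr_respects R).
Qed.
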